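(* Let $E$ be a Banach lattice and let $F$ be a Banach lattice with order continuous norm. Then the collection of all order bounded AM-un-compact operators from $E$ into $F$ is a band in $L^b(E,F)$. Likewise, the collection of all order bounded AM-$\sigma$-un-compact operators from $E$ into $F$ is a band in $L^b(E,F)$.
   Context: For $x\in E_+$, $[-x,x]=\{y\in E:-x\le y\le x\}$. A net $(y_\alpha)$ in a Banach lattice $F$ is un-convergent to $y\in F$ if $\||y_\alpha-y|\wedge u\|\to 0$ for every $u\in F_+$. A continuous linear operator $T:E\to F$ is AM-un-compact if for every $x\in E_+$ the bounded set $T[-x,x]$ is un-compact, meaning that every net in $T[-x,x]$ has a subnet that is un-convergent in $F$; it is AM-$\sigma$-un-compact if for every $x\in E_+$ every sequence in $T[-x,x]$ has a subsequence that is un-convergent in $F$. $L^b(E,F)$ is the vector lattice of order bounded linear operators $E\to F$ (those mapping order intervals into order bounded sets), ordered by $S\le T$ iff $Sx\le Tx$ for all $x\in E_+$; it is a Riesz space because $F$ is Dedekind complete. A Banach lattice has order continuous norm if $x_\alpha\downarrow 0$ implies $\|x_\alpha\|\to 0$. *)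

(* Defs.v *)
From HB Require Import structures.
From mathcomp Require Import all_boot all_order all_algebra.
From mathcomp Require Import all_classical all_reals all_analysis.
Import Order.TTheory GRing.Theory Num.Theory.
Import numFieldNormedType.Exports.

Set Implicit Arguments.
Unset Strict Implicit.
Unset Printing Implicit Defensive.

Local Open Scope classical_set_scope.
Local Open Scope ring_scope.

(* The vector order is a relation of its own, x <=v y, and not an instance of
   Order.POrder: Hierarchy Builder rejects a structure that combines a
   MathComp order with NormedModule and is not a Num.NumDomain. *)
HB.mixin Record Lmodule_isOrderedVector (R : realType) V
    of GRing.Lmodule R V := {
  vle : V -> V -> Prop ;
  vle_refl : forall x : V, vle x x ;
  vle_anti : forall x y : V, vle x y -> vle y x -> x = y ;
  vle_trans : forall x y z : V, vle x y -> vle y z -> vle x z ;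
  vle_add2r : forall x y z : V, vle x y -> vle (x + z) (y + z) ;
  vle_scale : forall (a : R) (x : V), 0 <= a -> vle 0 x -> vle 0 (a *: x)
}.

#[short(type="orderedVectType")]
HB.structure Definition OrderedVector (R : realType) :=
  {V of GRing.Lmodule R V & Lmodule_isOrderedVector R V}.

Notation "x <=v y" := (vle x y) (at level 70, no associativity) : ring_scope.

Definition is_sup (R : realType) (V : orderedVectType R) (A : set V) (m : V) :=
  (forall x, A x -> x <=v m) /\
  (forall b, (forall x, A x -> x <=v b) -> m <=v b).

Definition is_inf (R : realType) (V : orderedVectType R) (A : set V) (m : V) :=
  (forall x, A x -> m <=v x) /\
  (forall b, (forall x, A x -> b <=v x) -> b <=v m).

HB.mixin Record OrderedVector_isRiesz (R : realType) V of OrderedVector R V := {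
  vjoin : V -> V -> V ;
  vmeet : V -> V -> V ;
  vjoinP : forall x y : V, is_sup [set x; y] (vjoin x y) ;
  vmeetP : forall x y : V, is_inf [set x; y] (vmeet x y)
}.

#[short(type="rieszType")]
HB.structure Definition Riesz (R : realType) :=
  {V of OrderedVector R V & OrderedVector_isRiesz R V}.

(* The modulus |x| of the Riesz space; `|x| always denotes the norm. *)
Definition vabs (R : realType) (V : rieszType R) (x : V) : V := vjoin x (- x).

HB.mixin Record Riesz_isBanachLattice (R : realType) E
    of Riesz R E & CompleteNormedModule R E := {
  lattice_norm : forall x y : E, vabs x <=v vabs y -> `|x| <= `|y|
}.

#[short(type="banachLatticeType")]
HB.structure Definition BanachLattice (R : realType) :=
  {E of Riesz R E & CompleteNormedModule R E & Riesz_isBanachLattice R E}.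

Record directedSet := DirectedSet {
  dcarrier :> Type ;
  dle : dcarrier -> dcarrier -> Prop ;
  dle_refl : forall a, dle a a ;
  dle_trans : forall a b c, dle a b -> dle b c -> dle a c ;
  directed_ub : forall a b, exists c, dle a c /\ dle b c ;
  directed_inh : inhabited dcarrier
}.

(* The filter of tails: convergence of a net along D is convergence along it. *)
Definition tails (D : directedSet) : set_system D :=
  [set P | exists a, forall b, dle a b -> P b].

(* For such phi, y \o phi : D' -> T is a subnet of y : D -> T. *)
Definition subnet_map (D D' : directedSet) (phi : D' -> D) :=
  forall a, exists a', forall b', dle a' b' -> dle a (phi b').

Section BanachLattices.
Variable R : realType.

Definition order_continuous_norm (E : banachLatticeType R) :=
  forall (D : directedSet) (x : D -> E),
    (forall a b, dle a b -> x b <=v x a) ->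
    is_inf (range x) 0 ->
    (fun a => `|x a|) @ @tails D --> (0 : R).

(* G is the tail filter for a net, and \oo for a sequence. *)
Definition un_cvg (F : banachLatticeType R) (I : Type) (G : set_system I)
    (y : I -> F) (l : F) :=
  forall u : F, 0 <=v u ->
    (fun i => `|vmeet (vabs (y i - l)) u|) @ G --> (0 : R).

Definition un_compact (F : banachLatticeType R) (A : set F) :=
  forall (D : directedSet) (y : D -> F), (forall a, A (y a)) ->
  exists (D' : directedSet) (phi : D' -> D) (l : F),
    subnet_map phi /\ un_cvg (@tails D') (y \o phi) l.

Definition sigma_un_compact (F : banachLatticeType R) (A : set F) :=
  forall y : nat -> F, (forall n, A (y n)) ->
  exists (phi : nat -> nat) (l : F),
    {homo phi : m n / (m < n)%N} /\ un_cvg \oo (y \o phi) l.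

Definition ointerval (E : banachLatticeType R) (a b : E) : set E :=
  [set y | a <=v y /\ y <=v b].

Definition AM_un_compact (E F : banachLatticeType R) (T : E -> F) :=
  [/\ linear T, continuous T &
      forall x : E, 0 <=v x -> un_compact (T @` ointerval (- x) x)].

Definition AM_sigma_un_compact (E F : banachLatticeType R) (T : E -> F) :=
  [/\ linear T, continuous T &
      forall x : E, 0 <=v x -> sigma_un_compact (T @` ointerval (- x) x)].

Definition order_bounded (E F : banachLatticeType R) (T : E -> F) :=
  forall a b : E, exists c d : F, T @` ointerval a b `<=` ointerval c d.

Lemma vle_add (V : orderedVectType R) (x y z t : V) :
  x <=v y -> z <=v t -> x + z <=v y + t.
Proof.
move=> xy zt; apply: (vle_trans _ _ _ (vle_add2r _ _ z xy)).
by rewrite addrC [y + t]addrC; exact: vle_add2r.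
Qed.

Lemma vle_sub_ge0 (V : orderedVectType R) (x y : V) :
  0 <=v y - x <-> x <=v y.
Proof.
split=> h; first by have := vle_add2r _ _ x h; rewrite add0r subrK.
by have := vle_add2r _ _ (- x) h; rewrite subrr.
Qed.

Lemma vle_scale2 (V : orderedVectType R) (k : R) (x y : V) :
  0 <= k -> x <=v y -> k *: x <=v k *: y.
Proof.
move=> k0 xy; apply/vle_sub_ge0; rewrite -scalerBr.
by apply: vle_scale => //; apply/vle_sub_ge0.
Qed.

Lemma vle_scale2n (V : orderedVectType R) (k : R) (x y : V) :
  k <= 0 -> x <=v y -> k *: y <=v k *: x.
Proof.
move=> k0 xy; apply/vle_sub_ge0; rewrite -scalerBr -opprB scalerN -scaleNr.
by apply: vle_scale; rewrite ?oppr_ge0//; apply/vle_sub_ge0.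
Qed.

End BanachLattices.

Section OrderBoundedOperators.
Variables (R : realType) (E F : banachLatticeType R).

Definition Lb_pred : {pred E -> F} :=
  [pred T | `[< linear T /\ order_bounded T >]].

Record Lb := MkLb { Lb_fun :> E -> F ; _ : Lb_fun \in Lb_pred }.

HB.instance Definition _ := [isSub for Lb_fun].
HB.instance Definition _ := [Choice of Lb by <:].

Lemma LbP (T : Lb) : linear T /\ order_bounded T.
Proof. by apply/asboolP; exact: valP T. Qed.

Fact Lb_submod_closed : submod_closed Lb_pred.
Proof.
split.
  apply/asboolP; split.
    by move=> k x y; rewrite /= scaler0 addr0.
  move=> a b; exists 0, 0 => _ [x _ <-].
  by split; exact: vle_refl.
move=> k f g /asboolP[lf bf] /asboolP[lg bg].
apply/asboolP; split.
  move=> c x y; rewrite !fctE lf lg !scalerDr !scalerA [c * k]mulrC.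
  by rewrite addrACA.
move=> a b.
have [c [d fab]] := bf a b; have [c' [d' gab]] := bg a b.
have [k0|k0] := leP 0 k.
  exists (k *: c + c'), (k *: d + d') => _ [x xab <-].
  have [f1 f2] := fab _ (imageP _ xab).
  have [g1 g2] := gab _ (imageP _ xab).
  by split; apply: vle_add => //; apply: vle_scale2.
exists (k *: d + c'), (k *: c + d') => _ [x xab <-].
have [f1 f2] := fab _ (imageP _ xab).
have [g1 g2] := gab _ (imageP _ xab).
by split; apply: vle_add => //; apply: vle_scale2n => //; exact: ltW.
Qed.

HB.instance Definition _ :=
  GRing.isSubmodClosed.Build R (E -> F) Lb_pred Lb_submod_closed.
HB.instance Definition _ := [SubChoice_isSubLmodule of Lb by <:].

Definition Lb_le (S T : Lb) : Prop := forall x : E, 0 <=v x -> S x <=v T x.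

Fact Lb_le_refl S : Lb_le S S.
Proof. by move=> x _; exact: vle_refl. Qed.

Fact Lb_le_anti S T : Lb_le S T -> Lb_le T S -> S = T.
Proof.
move=> ST TS; apply/val_inj/funext => x /=.
have eqp z : 0 <=v z -> S z = T z.
  by move=> z0; apply: vle_anti; [exact: ST|exact: TS].
have [ub _] := vjoinP x (0 : E).
have xj : x <=v vjoin x 0 by apply: ub; left.
have j0 : 0 <=v vjoin x (0 : E) by apply: ub; right.
have -> : x = (-1) *: (vjoin x 0 - x) + vjoin x 0.
  by rewrite scaleN1r opprB subrK.
by rewrite (LbP S).1 (LbP T).1 !eqp//; apply/vle_sub_ge0.
Qed.

Fact Lb_le_trans S T U : Lb_le S T -> Lb_le T U -> Lb_le S U.
Proof. by move=> ST TU x x0; exact: vle_trans (ST _ x0) (TU _ x0). Qed.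

Fact Lb_le_add2r S T U : Lb_le S T -> Lb_le (S + U) (T + U).
Proof. by move=> ST x x0; exact: vle_add2r (ST _ x0). Qed.

Fact Lb_le_scale (a : R) T : 0 <= a -> Lb_le 0 T -> Lb_le 0 (a *: T).
Proof. by move=> a0 T0 x x0; exact: vle_scale (T0 _ x0). Qed.

HB.instance Definition _ := Lmodule_isOrderedVector.Build R Lb
  Lb_le_refl Lb_le_anti Lb_le_trans Lb_le_add2r Lb_le_scale.

End OrderBoundedOperators.

Section Bands.
Variables (R : realType) (V : orderedVectType R).

Definition vector_lattice := forall v w : V, exists m, is_sup [set v; w] m.

Definition is_modulus (v m : V) := is_sup [set v; - v] m.

Definition linear_subspace (B : set V) :=
  B 0 /\ forall (a : R) (v w : V), B v -> B w -> B (a *: v + w).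

Definition solid (B : set V) :=
  forall v w mv mw : V, is_modulus v mv -> is_modulus w mw ->
    mv <=v mw -> B w -> B v.

(* A band of a Riesz space is an ideal (solid subspace) containing the supremum
   of each of its subsets that has one. The type V carries no lattice
   operations, since for V = Lb E F they exist only under a hypothesis on F;
   vector_lattice states that they exist, so that solid has its usual meaning. *)
Definition is_band (B : set V) :=
  [/\ vector_lattice, linear_subspace B, solid B &
      forall (A : set V) (m : V), A `<=` B -> is_sup A m -> B m].

End Bands.

(* Main.v *)
From HB Require Import structures.
Require Import Defs.
From mathcomp Require Import all_boot all_order all_algebra.
From mathcomp Require Import all_classical all_reals all_analysis.
From mathcomp Require Import lra ring.
Import Order.TTheory GRing.Theory Num.Theory.
Import numFieldNormedType.Exports.

Set Implicit Arguments.
Unset Strict Implicit.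
Unset Printing Implicit Defensive.

Local Open Scope classical_set_scope.
Local Open Scope ring_scope.

(** For an order bounded operator T both compactness conditions say the same
    thing, namely that T maps order intervals to norm totally bounded sets
    ([AM_compact]): the terms of a net in an order interval [c, d] differ by at
    most d - c, so truncation at d - c is invisible and un-convergence makes the
    net norm Cauchy.  Conversely a net or sequence in a totally bounded set has
    a norm cluster point, and norm convergence implies un-convergence; continuity
    of T is automatic ([order_bounded_continuous]).  Hence both collections are
    one set of operators, and the content is that the AM-compact operators form a
    band.

    Order continuity of the norm of F enters through [directed_sup]: a directed
    set bounded above has a supremum, and elements of the set come close to it in
    norm.  It makes F Dedekind complete, so that the join of two operators exists
    and is given by the Riesz-Kantorovich formula, here as the supremum of the
    sums of the S x_i \/ T x_i over the partitions x = x_1 + ... + x_n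
    ([Lb_join]); suprema of directed sets of operators are pointwise
    ([Lb_directed_sup]); and band projections exist ([band_projection]), both in
    F and in the lattice of operators.

    The key step ([psum_approx], [AM_compact_disjoint]) is that if S1 and S2 are
    positive and disjoint and S1 + S2 or S1 - S2 is AM-compact, then so is S1.
    Disjointness provides a partition of x for which S1 x_i and S2 x_i are nearly
    disjoint in F.  If P_i is the band projection of F onto the band where
    S1 x_i exceeds S2 x_i, then S1 is close to P_i (S1 + S2), and to
    P_i (S1 - S2), uniformly on [0, x_i].  By Riesz decomposition each y in [0, x]
    is a sum of some y_i in [0, x_i], so S1 [0, x] lies near a finite sum of
    images of totally bounded sets.

    Applied to T = T^+ - T^- this yields that T^+ is AM-compact.  Applied to a
    component C of a positive T and to T - C it yields that C is AM-compact, and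
    each S between 0 and T is a uniform limit of dyadic combinations of such
    components ([half_component], [AM_compact_dominated]).  These two facts give
    solidity.  Closure under suprema follows by passing to finite joins: the
    supremum of the resulting directed set is approximated at x, and therefore on
    all of [0, x], by its elements. *)

(** * Linear identities and inequalities in a vector space *)

Section VectorIdentities.
Variables (R : realType) (V : lmodType R).

Inductive vexpr :=
  | VVar of nat | VZero | VAdd of vexpr & vexpr | VOpp of vexpr
  | VScale of R & vexpr.

Fixpoint veval (env : seq V) (e : vexpr) : V :=
  match e with
  | VVar i => nth 0 env i
  | VZero => 0
  | VAdd a b => veval env a + veval env b
  | VOpp a => - veval env a
  | VScale k a => k *: veval env a
  end.

Fixpoint vcoef (e : vexpr) (i : nat) : R :=
  match e with
  | VVar j => if Nat.eqb j i then 1 else 0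
  | VZero => 0
  | VAdd a b => vcoef a i + vcoef b i
  | VOpp a => - vcoef a i
  | VScale k a => k * vcoef a i
  end.

Fixpoint same_vcoefs (a b : vexpr) (n : nat) : Prop :=
  if n is m.+1 then vcoef a m = vcoef b m /\ same_vcoefs a b m else True.

Lemma veval_vcoef env e :
  veval env e = \sum_(i < size env) vcoef e i *: env`_i.
Proof.
elim: e => [j||a iha b ihb|a iha|k a iha] /=.
- have eqbE i : Nat.eqb j i = (j == i) by apply/PeanoNat.Nat.eqb_spec/eqP.
  have [jn|jn] := ltnP j (size env).
    rewrite (bigD1 (Ordinal jn)) //= eqbE eqxx scale1r big1 ?addr0 // => i ij.
    rewrite eqbE ifN ?scale0r //; apply: contra ij => /eqP ji.
    by apply/eqP/val_inj.
  rewrite nth_default // big1 // => i _; rewrite eqbE ifN ?scale0r //.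
  by rewrite neq_ltn (leq_trans (ltn_ord i) jn) orbT.
- by rewrite big1 // => i _; rewrite scale0r.
- by rewrite iha ihb -big_split; apply: eq_bigr => i _; rewrite scalerDl.
- by rewrite iha -sumrN; apply: eq_bigr => i _; rewrite scaleNr.
- by rewrite iha scaler_sumr; apply: eq_bigr => i _; rewrite scalerA.
Qed.

(** Soundness of the tactic [vec] below: a vector identity holds as soon as the
    coefficients of each atom agree, which is an identity between scalars. *)
Lemma veval_eq env a b :
  same_vcoefs a b (size env) -> veval env a = veval env b.
Proof.
rewrite !veval_vcoef => h; apply: eq_bigr => i _; congr (_ *: _).
elim: (size env) i h => [[]//|n ihn] i /= [abn abs].
have [->//|ni] := eqVneq (i : nat) n.
have lin : (i < n)%N by rewrite ltn_neqAle ni -ltnS /=.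
exact: (ihn (Ordinal lin)).
Qed.

End VectorIdentities.

(* Atoms are compared up to conversion, since the same vector may occur with
   different paths through the hierarchy of structures. *)
Ltac vec_same x y :=
  match goal with
  | _ => let _ := match goal with _ => constr_eq x y end in constr:(true)
  | _ => let _ := match goal with _ => unify x y end in constr:(true)
  | _ => constr:(false)
  end.

Ltac vec_atom x l :=
  match l with
  | nil => constr:(x :: l)
  | ?y :: ?m =>
    match vec_same x y with
    | true => l
    | false => let m' := vec_atom x m in constr:(y :: m')
    end
  end.

Ltac vec_atoms t l :=
  lazymatch t with
  | (?a + ?b)%R => let m := vec_atoms a l in vec_atoms b m
  | (- ?a)%R => vec_atoms a l
  | (_ *: ?a)%R => vec_atoms a l
  | 0%R => l
  | _ => vec_atom t l
  end.

Ltac vec_index x l :=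
  match l with
  | ?y :: ?m =>
    match vec_same x y with
    | true => constr:(0%N)
    | false => let i := vec_index x m in constr:(S i)
    end
  end.

Ltac vec_reify R t l :=
  lazymatch t with
  | (?a + ?b)%R =>
    let a' := vec_reify R a l in let b' := vec_reify R b l in
    constr:(VAdd a' b')
  | (- ?a)%R => let a' := vec_reify R a l in constr:(VOpp a')
  | (?k *: ?a)%R => let a' := vec_reify R a l in constr:(VScale k a')
  | 0%R => constr:(VZero R)
  | _ => let i := vec_index t l in constr:(VVar R i)
  end.

(* [vec R] proves an identity between linear combinations of vectors over R. *)
Ltac vec R :=
  lazymatch goal with
  | |- @eq ?V ?a ?b =>
    let l := vec_atoms a (@nil V) in
    let l := vec_atoms b l in
    let a' := vec_reify R a l in
    let b' := vec_reify R b l in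
    apply: (@veval_eq R _ l a' b'); cbn [same_vcoefs vcoef size Nat.eqb];
    repeat split; lra
  end.

(** ** Ordered vector spaces *)

Section OrderedVectorSpace.
Variables (R : realType) (V : orderedVectType R).
Implicit Types (x y z a b : V).

Lemma vle_by1 x y a b : x <=v y -> b - a = y - x -> a <=v b.
Proof. by move=> /vle_sub_ge0 + e; rewrite -e => /vle_sub_ge0. Qed.

Lemma vle_by2 x y x' y' a b :
  x <=v y -> x' <=v y' -> b - a = (y - x) + (y' - x') -> a <=v b.
Proof.
move=> h h' e; apply: (vle_by1 (vle_add h h')); rewrite e; vec R.
Qed.

Lemma vge0_add x y : 0 <=v x -> 0 <=v y -> 0 <=v x + y.
Proof. by move=> x0 y0; apply: (vle_by2 x0 y0); vec R. Qed.

Lemma vle_pscalel (k : R) x y : 0 < k -> (k *: x <=v y <-> x <=v k^-1 *: y).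
Proof.
move=> k0; have kge0 : 0 <= k := ltW k0.
have ki0 : 0 <= k^-1 by rewrite invr_ge0.
split=> h.
  by have := vle_scale2 ki0 h; rewrite scalerA mulVf ?gt_eqF // scale1r.
by have := vle_scale2 kge0 h; rewrite scalerA divff ?gt_eqF // scale1r.
Qed.

Lemma vle_pscaler (k : R) x y : 0 < k -> (x <=v k *: y <-> k^-1 *: x <=v y).
Proof.
by move=> k0; rewrite vle_pscalel ?invr_gt0 // invrK.
Qed.

End OrderedVectorSpace.

Section LinearMaps.
Variables (R : realType) (U V : lmodType R) (f : U -> V).
Hypothesis fl : linear f.

Lemma lin0 : f 0 = 0.
Proof. by have := fl (-1) 0 0; rewrite scaler0 addr0 scaleN1r addNr. Qed.

Lemma linZ k x : f (k *: x) = k *: f x.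
Proof. by have := fl k x 0; rewrite !addr0 lin0 addr0. Qed.

Lemma linD x y : f (x + y) = f x + f y.
Proof. by have := fl 1 x y; rewrite !scale1r. Qed.

Lemma linB x y : f (x - y) = f x - f y.
Proof. by rewrite linD -scaleN1r linZ scaleN1r. Qed.

End LinearMaps.

Section PositiveMaps.
Variables (R : realType) (U V : orderedVectType R) (f : U -> V).
Hypotheses (fl : linear f) (f0 : forall x, 0 <=v x -> 0 <=v f x).

Lemma pos_mono x y : x <=v y -> f x <=v f y.
Proof.
by move=> /vle_sub_ge0 xy; apply/vle_sub_ge0; rewrite -(linB fl); exact: f0.
Qed.

End PositiveMaps.

(** * Riesz spaces *)

Section RieszSpace.
Variables (R : realType) (V : rieszType R).
Implicit Types (x y z a b c d u v : V).

Lemma vle_joinl x y : x <=v vjoin x y.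
Proof. by apply: (vjoinP x y).1; left. Qed.

Lemma vle_joinr x y : y <=v vjoin x y.
Proof. by apply: (vjoinP x y).1; right. Qed.

Lemma vjoin_le x y b : x <=v b -> y <=v b -> vjoin x y <=v b.
Proof. by move=> xb yb; apply: (vjoinP x y).2 => _ [|] ->. Qed.

Lemma vmeet_lel x y : vmeet x y <=v x.
Proof. by apply: (vmeetP x y).1; left. Qed.

Lemma vmeet_ler x y : vmeet x y <=v y.
Proof. by apply: (vmeetP x y).1; right. Qed.

Lemma vle_meet x y b : b <=v x -> b <=v y -> b <=v vmeet x y.
Proof. by move=> bx yb; apply: (vmeetP x y).2 => _ [|] ->. Qed.

Definition vpos x := vjoin x 0.

Lemma vpos_ge0 x : 0 <=v vpos x. Proof. exact: vle_joinr. Qed.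

Lemma vle_pos x : x <=v vpos x. Proof. exact: vle_joinl. Qed.

Lemma vposN x : vpos (- x) = vpos x - x.
Proof.
apply: vle_anti.
  apply: vjoin_le; first by apply: (vle_by1 (vpos_ge0 x)); vec R.
  by apply: (vle_by1 (vle_pos x)); vec R.
rewrite -vle_sub_ge0; suff : vpos x <=v vpos (- x) + x.
  by move=> h; apply: (vle_by1 h); vec R.
apply: vjoin_le; first by apply: (vle_by1 (vpos_ge0 (- x))); vec R.
by apply: (vle_by1 (vle_pos (- x))); vec R.
Qed.

Lemma vposBneg x : vpos x - vpos (- x) = x.
Proof. by rewrite vposN; vec R. Qed.

Lemma vpos_neg_disjoint x b : b <=v vpos x -> b <=v vpos (- x) -> b <=v 0.
Proof.
rewrite vposN => bx bNx.
suff h : vpos x <=v vpos x - b by apply: (vle_by1 h); vec R.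
apply: vjoin_le; first by apply: (vle_by1 bNx); vec R.
by apply: (vle_by1 bx); vec R.
Qed.

Lemma vjoinE x y : vjoin x y = y + vpos (x - y).
Proof.
apply: vle_anti.
  apply: vjoin_le; first by apply: (vle_by1 (vle_pos (x - y))); vec R.
  by apply: (vle_by1 (vpos_ge0 (x - y))); vec R.
suff h : vpos (x - y) <=v vjoin x y - y by apply: (vle_by1 h); vec R.
apply: vjoin_le; first by apply: (vle_by1 (vle_joinl x y)); vec R.
by apply: (vle_by1 (vle_joinr x y)); vec R.
Qed.

Lemma vmeet_ge0 x y : 0 <=v x -> 0 <=v y -> 0 <=v vmeet x y.
Proof. exact: vle_meet. Qed.

Lemma vmeet_le2 x y a b : x <=v a -> y <=v b -> vmeet x y <=v vmeet a b.
Proof.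
move=> xa yb; apply: vle_meet.
  exact: vle_trans (vmeet_lel _ _) xa.
exact: vle_trans (vmeet_ler _ _) yb.
Qed.

Lemma vmeet_addl_le x y u : 0 <=v x -> 0 <=v y -> 0 <=v u ->
  vmeet (x + y) u <=v vmeet x u + vmeet y u.
Proof.
move=> x0 y0 u0.
suff h : vmeet (x + y) u - vmeet x u <=v vmeet y u.
  by apply: (vle_by1 h); vec R.
apply: vle_meet; last first.
  by apply: (vle_by2 (vmeet_ler (x + y) u) (vmeet_ge0 x0 u0)); vec R.
suff h : vmeet (x + y) u - y <=v vmeet x u by apply: (vle_by1 h); vec R.
apply: vle_meet; first by apply: (vle_by1 (vmeet_lel (x + y) u)); vec R.
by apply: (vle_by2 (vmeet_ler (x + y) u) y0); vec R.
Qed.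

Lemma riesz_decomposition x a b :
  0 <=v x -> 0 <=v a -> 0 <=v b -> x <=v a + b ->
  exists x1 x2, [/\ x = x1 + x2, 0 <=v x1, x1 <=v a, 0 <=v x2 & x2 <=v b].
Proof.
move=> x0 a0 b0 xab; exists (vmeet x a), (x - vmeet x a); split.
- by vec R.
- exact: vmeet_ge0.
- exact: vmeet_ler.
- by apply: (vle_by1 (vmeet_lel x a)); vec R.
- suff h : x - b <=v vmeet x a by apply: (vle_by1 h); vec R.
  apply: vle_meet; first by apply: (vle_by1 b0); vec R.
  by apply: (vle_by1 xab); vec R.
Qed.

(** The 2 x 2 case of common refinements is all that is needed for partitions
    built by successive splittings. *)
Lemma riesz_refinement a b c d :
  0 <=v a -> 0 <=v b -> 0 <=v c -> 0 <=v d -> a + b = c + d ->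
  exists a1 a2 b1 b2, [/\ a = a1 + a2, b = b1 + b2, c = a1 + b1 & d = a2 + b2]
    /\ [/\ 0 <=v a1, 0 <=v a2, 0 <=v b1 & 0 <=v b2].
Proof.
move=> a0 b0 c0 d0 abcd.
have acd : a <=v c + d by rewrite -abcd; apply: (vle_by1 b0); vec R.
have [a1 [a2 [aE a10 a1c a20 a2d]]] := riesz_decomposition a0 c0 d0 acd.
exists a1, a2, (c - a1), (d - a2).
split; split=> //; try by vec R.
- have -> : b = c + d - a by rewrite -abcd; vec R.
  by rewrite aE; vec R.
- by apply/vle_sub_ge0.
- by apply/vle_sub_ge0.
Qed.

Lemma vle_abs x : x <=v vabs x. Proof. exact: vle_joinl. Qed.

Lemma vleN_abs x : - x <=v vabs x. Proof. exact: vle_joinr. Qed.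

Lemma vabs_le x b : x <=v b -> - x <=v b -> vabs x <=v b.
Proof. exact: vjoin_le. Qed.

Lemma vge0_dbl x : 0 <=v x + x -> 0 <=v x.
Proof.
move=> xx0; have -> : x = 2^-1 *: (x + x) by vec R.
by apply: vle_scale.
Qed.

Lemma vabs_ge0 x : 0 <=v vabs x.
Proof.
apply: vge0_dbl; apply: (vle_by2 (vle_abs x) (vleN_abs x)); vec R.
Qed.

Lemma vabs_id x : 0 <=v x -> vabs x = x.
Proof.
move=> x0; apply: vle_anti; last exact: vle_abs.
apply: vabs_le; first exact: vle_refl.
by apply: (vle_by2 x0 x0); vec R.
Qed.

Lemma vabsN x : vabs (- x) = vabs x.
Proof.
apply: vle_anti; apply: vabs_le; rewrite ?opprK.
- exact: vleN_abs.
- exact: vle_abs.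
- by rewrite -[x in X in X <=v _]opprK; exact: vleN_abs.
- exact: vle_abs.
Qed.

Lemma vabs_add x y : vabs (x + y) <=v vabs x + vabs y.
Proof.
apply: vabs_le.
  exact: vle_add (vle_abs x) (vle_abs y).
by apply: (vle_by2 (vleN_abs x) (vleN_abs y)); vec R.
Qed.

End RieszSpace.

Section DirectedSets.
Variables (R : realType) (V : orderedVectType R).

Definition directed_up (A : set V) :=
  forall a b, A a -> A b -> exists c, [/\ A c, a <=v c & b <=v c].

(** For a Riesz space this is Dedekind completeness; in this form it makes sense
    for a space of operators before its lattice operations are known. *)
Definition directed_complete := forall (A : set V) (b : V),
  A !=set0 -> directed_up A -> (forall a, A a -> a <=v b) ->
  exists m, is_sup A m.

Lemma is_sup_uniq (A : set V) m m' : is_sup A m -> is_sup A m' -> m = m'.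
Proof. by move=> [h1 h2] [h3 h4]; apply: vle_anti; [exact: h2|exact: h4]. Qed.

End DirectedSets.

(** * Linear maps as suprema of directed families of values *)

Section PositiveLinear.
Variables (R : realType) (X : rieszType R) (V : orderedVectType R).

(** Each vector is a difference of positive ones, and g p - g q depends only on
    p - q. *)
Lemma linear_extension (g : X -> V) :
  (forall x y, 0 <=v x -> 0 <=v y -> g (x + y) = g x + g y) ->
  (forall (k : R) x, 0 < k -> 0 <=v x -> g (k *: x) = k *: g x) ->
  exists G : X -> V, linear G /\ forall x, 0 <=v x -> G x = g x.
Proof.
move=> gD gZ.
have g0 : g 0 = 0.
  have := gD 0 0 (vle_refl 0) (vle_refl 0); rewrite addr0 => h.
  by apply: (addrI (g 0)); rewrite -h addr0.
pose G x := g (vpos x) - g (vpos (- x)).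
have Gsub p q : 0 <=v p -> 0 <=v q -> G (p - q) = g p - g q.
  move=> p0 q0; rewrite /G.
  have : g (vpos (p - q) + q) = g (vpos (- (p - q)) + p).
    congr (g _); rewrite vposN; vec R.
  rewrite !gD //; try exact: vpos_ge0; move=> e.
  have -> : g (vpos (p - q)) = g (vpos (- (p - q))) + g p - g q.
    by rewrite -e; vec R.
  by vec R.
have Gpos x : 0 <=v x -> G x = g x.
  by move=> x0; rewrite -[x in LHS]subr0 Gsub ?g0 ?subr0 //; exact: vle_refl.
have GD x y : G (x + y) = G x + G y.
  rewrite -[x in LHS]vposBneg -[y in LHS]vposBneg.
  have -> : vpos x - vpos (- x) + (vpos y - vpos (- y)) =
    (vpos x + vpos y) - (vpos (- x) + vpos (- y)) by vec R.
  rewrite Gsub ?gD; try exact: vpos_ge0; first by rewrite /G; vec R.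
    by apply: vge0_add; exact: vpos_ge0.
  by apply: vge0_add; exact: vpos_ge0.
have GN x : G (- x) = - G x by rewrite /G opprK; vec R.
have GZ (k : R) x : 0 < k -> G (k *: x) = k *: G x.
  move=> k0; rewrite -[x in LHS]vposBneg scalerBr Gsub.
  - by rewrite !gZ -?scalerBr //; exact: vpos_ge0.
  - by apply: vle_scale; [exact: ltW|exact: vpos_ge0].
  - by apply: vle_scale; [exact: ltW|exact: vpos_ge0].
exists G; split => // k x y; rewrite GD; congr (_ + _).
have [k0|k0|->] := ltgtP k 0; last 1 first.
- by rewrite !scale0r Gpos //; exact: vle_refl.
- have Nk0 : 0 < - k by rewrite oppr_gt0.
  have -> : k *: x = - (- k *: x) by vec R.
  by rewrite GN GZ //; vec R.
- exact: GZ.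
Qed.

(** Additivity of the family up to domination becomes additivity of its suprema.
    This is the common source of the band projections, of the join of two
    operators and of the supremum of a directed set of operators. *)
Lemma linear_sup (Phi : X -> set V) : directed_complete V ->
  (forall x, 0 <=v x -> Phi x !=set0) ->
  (forall x, 0 <=v x -> directed_up (Phi x)) ->
  (forall x, 0 <=v x -> exists b, forall v, Phi x v -> v <=v b) ->
  (forall x y v w, 0 <=v x -> 0 <=v y -> Phi x v -> Phi y w ->
     exists2 z, Phi (x + y) z & v + w <=v z) ->
  (forall x y z, 0 <=v x -> 0 <=v y -> Phi (x + y) z ->
     exists v w, [/\ Phi x v, Phi y w & z <=v v + w]) ->
  (forall (k : R) x v, 0 < k -> 0 <=v x -> Phi x v -> Phi (k *: x) (k *: v)) ->
  exists G : X -> V, linear G /\ forall x, 0 <=v x -> is_sup (Phi x) (G x).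
Proof.
move=> Vc Phi0 Phid Phib Phisup Phisub PhiZ.
have /choice[g gP] : forall x, exists m, 0 <=v x -> is_sup (Phi x) m.
  move=> x; have [x0|x0] := pselect (0 <=v x); last by exists 0 => /x0.
  have [b bub] := Phib _ x0.
  by have [m hm] := Vc _ _ (Phi0 _ x0) (Phid _ x0) bub; exists m.
have [||G [Gl GE]] := @linear_extension g.
- move=> x y x0 y0; have xy0 := vge0_add x0 y0.
  apply: is_sup_uniq (gP _ xy0) _.
  have [gx1 gx2] := gP _ x0; have [gy1 gy2] := gP _ y0; split.
    move=> z /Phisub[] // v [w [Pv Pw zvw]].
    by apply: vle_trans zvw _; apply: vle_add; [exact: gx1|exact: gy1].
  move=> b bub.
  suff h : g x <=v b - g y by apply: (vle_by1 h); vec R.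
  apply: gx2 => v Pv.
  suff h : g y <=v b - v by apply: (vle_by1 h); vec R.
  apply: gy2 => w Pw; have [z Pz vwz] := Phisup _ _ _ _ x0 y0 Pv Pw.
  by apply: (vle_by1 (vle_trans _ _ _ vwz (bub _ Pz))); vec R.
- move=> k x k0 x0.
  have kx0 : 0 <=v k *: x by apply: vle_scale => //; exact: ltW.
  apply: is_sup_uniq (gP _ kx0) _.
  have [gx1 gx2] := gP _ x0; split.
    move=> v Pv; apply/vle_pscaler => //; apply: gx1.
    have -> : x = k^-1 *: (k *: x).
      by rewrite scalerA mulVf ?gt_eqF // scale1r.
    by apply: PhiZ; rewrite ?invr_gt0.
  move=> b bub; apply/vle_pscalel => //; apply: gx2 => v Pv.
  by apply/vle_pscalel => //; apply: bub; exact: PhiZ.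
by exists G; split => // x x0; rewrite GE //; exact: gP.
Qed.

End PositiveLinear.

(** * Band projections *)

Section BandProjection.
Variables (R : realType) (V : rieszType R).

Definition projection_like (P : V -> V) :=
  linear P /\ forall x, 0 <=v x -> 0 <=v P x /\ P x <=v x.

(** The projection onto the band generated by the positive part u of f, given by
    the classical formula P x = sup (x /\ k u) over the multiples of u. *)
Lemma band_projection (f : V) : directed_complete V ->
  exists P : V -> V, [/\ projection_like P,
    (forall x, 0 <=v x -> P (P x) = P x),
    P (vpos f) = vpos f & P (vpos (- f)) = 0].
Proof.
move=> Vc; pose u := vpos f; have u0 : 0 <=v u := vpos_ge0 f.
have ku0 (k : R) : 0 <= k -> 0 <=v k *: u by move=> k0; exact: vle_scale.
have ku_le (k l : R) : k <= l -> k *: u <=v l *: u.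
  move=> kl; have h : 0 <=v (l - k) *: u by apply: ku0; rewrite subr_ge0.
  by apply: (vle_by1 h); vec R.
pose Phi (x : V) := [set vmeet x (k *: u) | k in [set k : R | 0 <= k]].
have [||||||P [Pl PP]] := @linear_sup R V V Phi Vc.
- by move=> x x0; exists (vmeet x (0 *: u)), 0 => //=.
- move=> x x0 _ _ [k /= k0 <-] [l /= l0 <-].
  exists (vmeet x ((k + l) *: u)); split.
  + by exists (k + l) => //=; exact: addr_ge0.
  + by apply: vmeet_le2; [exact: vle_refl|apply: ku_le; lra].
  + by apply: vmeet_le2; [exact: vle_refl|apply: ku_le; lra].
- by move=> x x0; exists x => _ [k _ <-]; exact: vmeet_lel.
- move=> x y _ _ x0 y0 [k /= k0 <-] [l /= l0 <-].
  exists (vmeet (x + y) ((k + l) *: u)).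
    by exists (k + l) => //=; exact: addr_ge0.
  apply: vle_meet; first by apply: vle_add; exact: vmeet_lel.
  by rewrite scalerDl; apply: vle_add; exact: vmeet_ler.
- move=> x y _ x0 y0 [k /= k0 <-].
  exists (vmeet x (k *: u)), (vmeet y (k *: u)); split; try by exists k.
  exact: vmeet_addl_le (ku0 _ k0).
- move=> k x _ k0 x0 [l /= l0 <-]; exists (k * l) => /=.
    by apply: mulr_ge0 => //; exact: ltW.
  apply: vle_anti; last first.
    apply: vle_meet; first by apply: vle_scale2 (vmeet_lel _ _); exact: ltW.
    by rewrite -scalerA; apply: vle_scale2 (vmeet_ler _ _); exact: ltW.
  apply/vle_pscaler => //; apply: vle_meet; apply/(vle_pscaler _ _ k0).
    exact: vmeet_lel.
  by rewrite scalerA; exact: vmeet_ler.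
have Pbd x : 0 <=v x -> 0 <=v P x /\ P x <=v x.
  move=> x0; have [ub least] := PP _ x0; split.
    apply: vle_trans (vmeet_ge0 x0 (ku0 0 (lexx _))) _.
    by apply: ub; exists 0 => /=.
  by apply: least => _ [k _ <-]; exact: vmeet_lel.
exists P; split => //.
- move=> x x0; have [Px0 Pxx] := Pbd _ x0.
  apply: vle_anti; first exact: (Pbd _ Px0).2.
  apply: (PP _ x0).2 => _ [k /= k0 <-].
  apply: (vle_trans _ (vmeet (P x) (k *: u))); last first.
    by apply: (PP _ Px0).1; exists k.
  apply: vle_meet (vmeet_ler _ _).
  by apply: (PP _ x0).1; exists k.
- apply: vle_anti; first exact: (Pbd _ u0).2.
  apply: (vle_trans _ (vmeet u (1 *: u))).
    by apply: vle_meet; rewrite ?scale1r; exact: vle_refl.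
  by apply: (PP _ u0).1; exists 1 => /=.
- have n0 := vpos_ge0 (- f).
  apply: vle_anti; last exact: (Pbd _ n0).1.
  apply: (PP _ n0).2 => _ [k /= k0 <-].
  (* dividing by k + 1 brings the lower bound below both parts of f *)
  set m := vmeet _ _; have k1 : 0 < k + 1 by lra.
  suff h : (k + 1)^-1 *: m <=v 0.
    by rewrite -(scaler0 _ (k + 1)); apply/vle_pscaler.
  apply: (@vpos_neg_disjoint _ _ f); apply/(vle_pscaler _ _ k1).
    by apply: vle_trans (vmeet_ler _ _) _; apply: ku_le; lra.
  apply: vle_trans (vmeet_lel _ _) _.
  by apply: (vle_by1 (vle_scale _ _ k0 n0)); vec R.
Qed.

End BandProjection.

Lemma projection_like_vabs (R : realType) (V : rieszType R) (P : V -> V) z :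
  projection_like P -> vabs (P z) <=v vabs z.
Proof.
move=> [Pl PP]; have [_ Pz] := PP _ (vabs_ge0 z).
have Pm := pos_mono Pl (fun x x0 => (PP x x0).1).
apply: vabs_le; apply: vle_trans Pz; first by apply: Pm; exact: vle_abs.
have -> : - P z = P (- z) by rewrite -scaleN1r -(linZ Pl) scaleN1r.
by apply: Pm; exact: vleN_abs.
Qed.

(** * Disjoint components in a Riesz space *)

Section Components.
Variables (R : realType) (V : rieszType R).
Implicit Types f s t : V.

(** Disjointness of p and n is stated as p + n being their supremum, a form in
    which it transfers to partition sums. *)
Lemma pos_part f : exists p n : V, [/\ f = p - n, 0 <=v p, 0 <=v n,
  is_sup [set p; n] (p + n) & is_sup [set f; 0] p].
Proof.
exists (vpos f), (vpos (- f)).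
have p0 := vpos_ge0 f; have n0 := vpos_ge0 (- f).
split => //; [by rewrite vposBneg| |exact: vjoinP].
split=> [_ [|] ->|b bub].
- by apply: (vle_by1 n0); vec R.
- by apply: (vle_by1 p0); vec R.
have bp : vpos f <=v b by apply: bub; left.
have bn : vpos (- f) <=v b by apply: bub; right.
have bf : f <=v b := vle_trans _ _ _ (vle_pos f) bp.
have bNf : - f <=v b := vle_trans _ _ _ (vle_pos (- f)) bn.
have half0 : 0 <= 2^-1 :> R by rewrite invr_ge0.
have half : vpos f <=v 2^-1 *: (b + f).
  apply: vjoin_le.
    by apply: (vle_by1 (vle_scale2 half0 bf)); vec R.
  by apply: (vle_by1 (vle_scale2 half0 bNf)); vec R.
have -> : b = 2 *: (2^-1 *: (b + f)) - f by vec R.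
rewrite vposN; have h := vle_scale2 (k := 2) (ler0n _ _) half.
by apply: (vle_by1 h); vec R.
Qed.

(** The dyadic step of Freudenthal's spectral theorem.  For functions, c is t
    on the set where 2 s > t and vanishes elsewhere. *)
Lemma half_component s t : directed_complete V -> 0 <=v s -> s <=v t ->
  exists c : V, [/\ 0 <=v c, c <=v t, is_sup [set c; t - c] t,
    2^-1 *: c <=v s & s - 2^-1 *: c <=v 2^-1 *: t].
Proof.
move=> Vc s0 st; have t0 := vle_trans _ _ _ s0 st.
pose f := 2 *: s - t.
have [P [[Pl PP] PPid Pp Pn]] := band_projection f Vc.
have Pm := pos_mono Pl (fun x x0 => (PP x x0).1).
have Pf : 2 *: P s - P t = vpos f.
  rewrite -(linZ Pl) -(linB Pl) -/f -(vposBneg f) (linB Pl) Pn Pp subr0.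
  by rewrite vposBneg.
have [Pt0 Ptt] := PP _ t0; have [Ps0 Pss] := PP _ s0.
exists (P t); split => //.
- split=> [_ [|] ->//|b bub]; first by apply: (vle_by1 Pt0); vec R.
  have bP : P t <=v b by apply: bub; left.
  have bQ : t - P t <=v b by apply: bub; right.
  have b0 := vle_trans _ _ _ Pt0 bP.
  have h1 : P t <=v P b by rewrite -(PPid _ t0); exact: Pm.
  (* the complementary projection 1 - P is positive too *)
  have h2 : 0 <=v b - (t - P t) - P (b - (t - P t)).
    by apply/vle_sub_ge0; apply: (PP _ _).2; apply/vle_sub_ge0.
  rewrite !(linB Pl) (PPid _ t0) in h2.
  by apply: (vle_by2 h1 h2); vec R.
- have h : 0 <=v 2^-1 *: (2 *: P s - P t).
    by apply: vle_scale; [rewrite invr_ge0|rewrite Pf; exact: vpos_ge0].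
  by apply: (vle_by2 h Pss); vec R.
- have h1 : 2^-1 *: f <=v 2^-1 *: vpos f.
    by apply: vle_scale2 (vle_pos f); rewrite invr_ge0.
  rewrite -Pf /f in h1; have h2 := Pm _ _ st.
  by apply: (vle_by2 h1 h2); vec R.
Qed.

End Components.

(** The space of operators carries no chosen lattice operations.  Facts about
    Riesz spaces that mention the order alone apply to it once suprema of pairs
    exist, the infimum of x and y being minus the supremum of - x and - y. *)
Lemma riesz_transfer (R : realType) (V : orderedVectType R)
    (Q : orderedVectType R -> Prop) :
  vector_lattice V -> (forall W : rieszType R, Q W) -> Q V.
Proof.
case: V Q => T c; pose V : orderedVectType R := OrderedVector.Pack c.
move=> Q h QW; have /choice[j jP] :
    forall p : V * V, exists m : V, is_sup [set p.1; p.2] m.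
  by move=> p; exact: h.
have joinP (x y : V) : is_sup [set x; y] (j (x, y)) by exact: (jP (x, y)).
have meetP (x y : V) : is_inf [set x; y] (- j (- x, - y)).
  have [/= ub least] := jP (- x, - y); split.
    move=> _ [|] ->.
      by apply: (vle_by1 (ub (- x) (or_introl erefl))); vec R.
    by apply: (vle_by1 (ub (- y) (or_intror erefl))); vec R.
  move=> b bub; have k : j (- x, - y) <=v - b.
    apply: least => _ [|] ->.
      by apply: (vle_by1 (bub x (or_introl erefl))); vec R.
    by apply: (vle_by1 (bub y (or_intror erefl))); vec R.
  by apply: (vle_by1 k); vec R.
pose lat := OrderedVector_isRiesz.Build R V joinP meetP.
pose W : rieszType R := HB.pack T c lat.
exact: (QW W).
Qed.

(** * Banach lattices *)

Global Instance tails_proper (D : directedSet) : ProperFilter (@tails D).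
Proof.
apply: Build_ProperFilter_ex.
  by move=> P [a aP]; exists a; apply: aP; exact: dle_refl.
split.
- by have [a] := directed_inh D; exists a.
- move=> P Q [a aP] [b bQ]; have [c [ac bc]] := directed_ub a b.
  exists c => d cd; split; [apply: aP|apply: bQ].
    exact: dle_trans ac cd.
  exact: dle_trans bc cd.
- by move=> P Q PQ [a aP]; exists a => b ab; apply/PQ/aP.
Qed.

Section BanachLattice.
Variables (R : realType) (F : banachLatticeType R).
Implicit Types (x y z u : F).

Lemma norm_vabs_le x y : vabs x <=v y -> `|x| <= `|y|.
Proof. by move=> xy; apply: lattice_norm; exact: vle_trans xy (vle_abs y). Qed.

Lemma norm_vabs x : `|vabs x| = `|x|.
Proof.
apply/eqP; rewrite eq_le; apply/andP; split.
  by apply: lattice_norm; rewrite vabs_id; [exact: vle_refl|exact: vabs_ge0].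
by apply: norm_vabs_le; exact: vle_refl.
Qed.

Lemma norm_vle x y : 0 <=v x -> x <=v y -> `|x| <= `|y|.
Proof. by move=> x0 xy; apply: norm_vabs_le; rewrite vabs_id. Qed.

(** The negative part of y is dominated by |x - y| for every positive x. *)
Lemma positive_cone_closed y :
  (forall e, 0 < e -> exists2 x, 0 <=v x & `|x - y| <= e) -> 0 <=v y.
Proof.
move=> h; suff : vpos (- y) = 0.
  by rewrite vposN => /subr0_eq <-; exact: vpos_ge0.
apply/normr0_eq0/eqP; rewrite eq_le normr_ge0 andbT; apply/ler_addgt0Pl => e e0.
rewrite addr0; have [x x0 xy] := h _ e0; apply: le_trans xy.
rewrite -(norm_vabs (x - y)); apply: norm_vle; first exact: vpos_ge0.
apply: vjoin_le; last exact: vabs_ge0.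
by apply: (vle_by2 (vle_abs (x - y)) x0); vec R.
Qed.

Lemma archimedean z y :
  0 <=v z -> (forall n : nat, n%:R *: z <=v y) -> z = 0.
Proof.
move=> z0 h; apply/normr0_eq0/eqP; rewrite eq_le normr_ge0 andbT leNgt.
apply/negP => zgt0.
pose n := (Num.truncn (`|y| / `|z|)).+1.
have : `|n%:R *: z| <= `|y| by apply: norm_vle => //; exact: vle_scale.
rewrite normrZ normr_nat -ler_pdivlMr // leNgt => /negP; apply.
exact: truncnS_gt.
Qed.

Hypothesis hF : order_continuous_norm F.

(** For a directed set bounded above, the net of differences between its upper
    bounds and its elements decreases to 0 by the Archimedean property. *)
Lemma directed_cauchy (A : set F) (b : F) :
  A !=set0 -> directed_up A -> (forall a, A a -> a <=v b) ->
  forall e, 0 < e ->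
  exists2 a, A a & forall a', A a' -> a <=v a' -> `|a' - a| <= e.
Proof.
move=> [a0 Aa0] Adir Ab e e0.
pose ub c := forall a, A a -> a <=v c.
pose D := {p : F * F | ub p.1 /\ A p.2}.
pose le (p q : D) := (sval q).1 <=v (sval p).1 /\ (sval p).2 <=v (sval q).2.
have le_refl p : le p p by split; exact: vle_refl.
have le_tr p q r : le p q -> le q r -> le p r.
  move=> [pq1 pq2] [qr1 qr2].
  by split; [exact: vle_trans qr1 pq1|exact: vle_trans pq2 qr2].
have le_dir p q : exists r, le p r /\ le q r.
  case: p q => [[c a] pA] [[c' a'] qA].
  have [uc Aa] : ub c /\ A a by [].
  have [uc' Aa'] : ub c' /\ A a' by [].
  have [a2 [Aa2 aa2 a'a2]] := Adir _ _ Aa Aa'.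
  have um : ub (vmeet c c').
    by move=> x Ax; apply: vle_meet; [exact: uc|exact: uc'].
  exists (exist _ (vmeet c c', a2) (conj um Aa2)).
  by split; split => //=; [exact: vmeet_lel|exact: vmeet_ler].
have Dinh : inhabited D by exact: (inhabits (exist _ (b, a0) (conj Ab Aa0))).
pose DD := DirectedSet le_refl le_tr le_dir Dinh.
pose x (p : DD) : F := (sval p).1 - (sval p).2.
have xdec (p q : DD) : dle p q -> x q <=v x p.
  by move=> [pq1 pq2]; apply: (vle_by2 pq1 pq2); rewrite /x; vec R.
have xinf : is_inf (range x) 0.
  split.
    by move=> _ [[[c a] pA] _ <-]; apply/vle_sub_ge0; exact: pA.1 pA.2.
  move=> z zlow.
  have zx c a : ub c -> A a -> vpos z <=v c - a.
    move=> uc Aa; apply: vjoin_le; last by apply/vle_sub_ge0; exact: uc.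
    by apply: zlow; exists (exist _ (c, a) (conj uc Aa)).
  (* subtracting z^+ from an upper bound gives again an upper bound *)
  have ubn n : ub (b - n%:R *: vpos z).
    elim: n => [|n ihn]; first by rewrite scale0r subr0.
    move=> a Aa; have := zx _ _ ihn Aa => h.
    have -> : n.+1%:R *: vpos z = n%:R *: vpos z + vpos z.
      by rewrite -natr1 scalerDl scale1r.
    by apply: (vle_by1 h); vec R.
  suff <- : vpos z = 0 by exact: vle_pos.
  apply: (@archimedean _ (b - a0)); first exact: vpos_ge0.
  by move=> n; apply: (vle_by1 (ubn n _ Aa0)); vec R.
have := hF xdec xinf; move=> /cvgrPdist_le /(_ _ e0) [[[c a] pA] h].
have [uc Aa] : ub c /\ A a by [].
exists a => // a' Aa' aa'.
have := h (exist _ (c, a) pA) (le_refl _); rewrite /x /=.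
rewrite sub0r normrN normr_id; apply: le_trans; apply: norm_vle.
  by apply/vle_sub_ge0.
by apply: (vle_by1 (uc _ Aa')); vec R.
Qed.

Definition section_filter (A : set F) : set_system F :=
  [set P | exists2 a, A a & forall a', A a' -> a <=v a' -> P a'].

Lemma section_filter_proper (A : set F) :
  A !=set0 -> directed_up A -> ProperFilter (section_filter A).
Proof.
move=> [a0 Aa0] Adir; apply: Build_ProperFilter_ex.
  by move=> P [a Aa aP]; exists a; apply: aP => //; exact: vle_refl.
split.
- by exists a0.
- move=> P Q [a Aa aP] [b Ab bQ].
  have [c [Ac ac bc]] := Adir _ _ Aa Ab.
  exists c => // c' Ac' cc'; split.
    by apply: aP => //; exact: vle_trans ac cc'.
  by apply: bQ => //; exact: vle_trans bc cc'.
- by move=> P Q PQ [a Aa aP]; exists a => // a' Aa' aa'; apply/PQ/aP.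
Qed.

(** The upward sections of A form a Cauchy filter, and its limit is the supremum
    because the positive cone is closed. *)
Lemma directed_sup (A : set F) (b : F) :
  A !=set0 -> directed_up A -> (forall a, A a -> a <=v b) ->
  exists2 m, is_sup A m &
    forall e, 0 < e -> exists2 a, A a & `|m - a| <= e.
Proof.
move=> A0 Adir Ab; have FP := section_filter_proper A0 Adir.
have : cauchy (section_filter A).
  apply: cauchy_exP => e e0.
  have e20 : 0 < e / 2 by rewrite divr_gt0.
  have [a Aa ah] := directed_cauchy A0 Adir Ab e20.
  exists a, a => // a' Aa' aa'; rewrite -ball_normE /= distrC.
  by apply: le_lt_trans (ah _ Aa' aa') _; lra.
move=> /cauchy_cvg; set m := lim _ => Am.
have mh a e : A a -> 0 < e -> exists a', [/\ A a', a <=v a' & `|m - a'| <= e].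
  move=> Aa e0; have [a1 Aa1 h1] := Am _ (nbhsx_ballx m e e0).
  have [a2 [Aa2 aa2 a1a2]] := Adir _ _ Aa Aa1.
  exists a2; split => //; have := h1 _ Aa2 a1a2.
  by rewrite -ball_normE /= => /ltW.
exists m; last first.
  move=> e e0; have [a Aa] := A0; have [a' [Aa' _ h]] := mh _ _ Aa e0.
  by exists a'.
split=> [a Aa|c cub]; apply/vle_sub_ge0; apply: positive_cone_closed => e e0.
  have [a' [Aa' aa' h]] := mh _ _ Aa e0.
  exists (a' - a); first exact/vle_sub_ge0.
  have -> : a' - a - (m - a) = - (m - a') by vec R.
  by rewrite normrN.
have [a Aa] := A0; have [a' [Aa' aa' h]] := mh _ _ Aa e0.
exists (c - a'); first by apply/vle_sub_ge0; exact: cub.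
have -> : c - a' - (c - m) = m - a' by vec R.
exact: h.
Qed.

Lemma order_continuous_directed_complete : directed_complete F.
Proof.
move=> A b A0 Adir Ab.
by have [m mA _] := directed_sup A0 Adir Ab; exists m.
Qed.

(** The form of [directed_sup] for a supremum already known from the order. *)
Lemma directed_sup_approx (A : set F) (m : F) :
  A !=set0 -> directed_up A -> is_sup A m ->
  forall e, 0 < e -> exists2 a, A a & `|m - a| <= e.
Proof.
move=> A0 Adir mA; have [m' m'A] := directed_sup A0 Adir mA.1.
by rewrite (is_sup_uniq mA m'A).
Qed.

End BanachLattice.


(** * Totally bounded sets and un-compactness *)

Section TotallyBounded.
Variables (R : realType) (F : banachLatticeType R).
Implicit Types (A B : set F).

Definition totally_bounded A := forall e : R, 0 < e ->
  exists s : seq F, forall y, A y -> exists2 c, c \in s & `|y - c| <= e.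

Lemma totally_bounded_approx A : (forall e : R, 0 < e -> exists2 B,
    totally_bounded B & forall y, A y -> exists2 b, B b & `|y - b| <= e) ->
  totally_bounded A.
Proof.
move=> h e e0; have e20 : 0 < e / 2 by rewrite divr_gt0.
have [B Btb AB] := h _ e20; have [s sB] := Btb _ e20.
exists s => y /AB[b /sB[c cs bc] yb]; exists c => //.
by apply: le_trans (ler_distD b _ _) _; lra.
Qed.

Lemma totally_bounded_sub A B : A `<=` B -> totally_bounded B ->
  totally_bounded A.
Proof.
by move=> AB Btb e /Btb[s sB]; exists s => y /AB; exact: sB.
Qed.

Lemma totally_bounded_add A B : totally_bounded A -> totally_bounded B ->
  totally_bounded [set x + y | x in A & y in B].
Proof.
move=> Atb Btb e e0; have e20 : 0 < e / 2 by rewrite divr_gt0.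
have [s sA] := Atb _ e20; have [t tB] := Btb _ e20.
exists [seq x + y | x <- s, y <- t] => _ [x Ax] [y By] <-.
have [a as_ xa] := sA _ Ax; have [b bt yb] := tB _ By.
exists (a + b); first exact: allpairs_f.
have -> : x + y - (a + b) = (x - a) + (y - b) by vec R.
by apply: le_trans (ler_normD _ _) _; lra.
Qed.

Lemma totally_bounded_lipschitz (f : F -> F) (k : R) A : 0 < k ->
  (forall x y, `|f x - f y| <= k * `|x - y|) ->
  totally_bounded A -> totally_bounded (f @` A).
Proof.
move=> k0 fk Atb e e0; have ek0 : 0 < e / k by rewrite divr_gt0.
have [s sA] := Atb _ ek0.
exists [seq f x | x <- s] => _ [x Ax <-].
have [c cs xc] := sA _ Ax; exists (f c); first exact: map_f.
apply: le_trans (fk _ _) _.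
by rewrite mulrC -ler_pdivlMr.
Qed.

(** An ultrafilter containing a totally bounded set contains a ball of each
    radius, hence is Cauchy. *)
Lemma totally_bounded_cluster A (G : set_system F) :
  totally_bounded A -> ProperFilter G -> G A ->
  exists l, forall (e : R) (P : set F), 0 < e -> G P ->
    exists2 y, P y & `|y - l| <= e.
Proof.
move=> Atb PG GA; have [U [UU GU]] := ultraFilterLemma PG.
have PU : ProperFilter U by exact: ultra_proper.
have : cauchy U.
  apply: cauchy_exP => e e0; have e20 : 0 < e / 2 by rewrite divr_gt0.
  have [s sA] := Atb _ e20.
  suff [c _ Uc] : exists2 c, c \in s & U (ball c e) by exists c.
  apply: contrapT => nUs.
  have : U (fun y => forall c, c \in s -> ~ ball c e y).
    have : forall c, c \in s -> ~ U (ball c e).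
      by move=> c cs Uc; apply: nUs; exists c.
    elim: s {sA nUs} => [|c s ihs] h.
      by apply: filterS filterT => y _ c; rewrite in_nil.
    have Us : U (fun y => forall d, d \in s -> ~ ball d e y).
      by apply: ihs => d ds; apply: h; rewrite in_cons ds orbT.
    have [Uc|Uc] := in_ultra_setVsetC (ball c e) UU.
      by case: (h c (mem_head _ _)).
    apply: filterS (filterI Us Uc) => y [ys yc] d.
    by rewrite in_cons => /orP[/eqP ->|/ys].
  move=> /(filterI (GU _ GA)) /filter_ex[y [/sA[c cs yc] ny]].
  apply: (ny _ cs); rewrite -ball_normE /= distrC.
  by apply: le_lt_trans yc _; lra.
move=> /cauchy_cvg; set l := lim _ => Ul.
exists l => e P e0 /GU UP.
have Ule : U (P `&` ball l e).
  by apply: filterI UP _; exact: Ul (nbhsx_ballx l e e0).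
have [y [Py ly]] := @filter_ex _ U PU _ Ule.
by exists y => //; move: ly; rewrite -ball_normE /= distrC => /ltW.
Qed.

(** Dependent choice of successive points outside the balls around the earlier
    ones. *)
Lemma not_totally_bounded A : ~ totally_bounded A ->
  exists (e : R) (y : nat -> F), [/\ 0 < e, forall n, A (y n) &
    forall m n, (m < n)%N -> e < `|y n - y m|].
Proof.
move=> /existsNP[e /not_implyP[e0 /forallNP nA]]; exists e.
have /choice[h hP] : forall s : seq F, exists y,
    A y /\ forall c, c \in s -> e < `|y - c|.
  move=> s; have /existsNP[y /not_implyP[Ay ny]] := nA s.
  exists y; split=> // c cs; rewrite ltNge; apply/negP => yc.
  by apply: ny; exists c.
pose L := fix L n := if n is n'.+1 then h (L n') :: L n' else [::].
exists (fun n => h (L n)); split => // [n|m n mn]; first exact: (hP _).1.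
apply: (hP _).2; elim: n mn => // n ihn; rewrite ltnS leq_eqVlt /= in_cons.
by move=> /orP[/eqP ->|/ihn ->]; rewrite ?eqxx ?orbT.
Qed.

(** Inside an order interval un-convergence gives norm Cauchy behaviour: two
    terms are at distance at most d - c, so that truncation at d - c does not
    affect their difference. *)
Lemma un_cvg_cauchy (I : Type) (G : set_system I) (y : I -> F) (l c d : F) :
  ProperFilter G -> (forall i, ointerval c d (y i)) -> un_cvg G y l ->
  forall e, 0 < e -> exists2 P, G P &
    forall i j, P i -> P j -> `|y i - y j| <= e.
Proof.
move=> PG ycd yl e e0; have e20 : 0 < e / 2 by rewrite divr_gt0.
have [i0 _] := filter_ex (@filterT _ G _).
have cd0 : 0 <=v d - c.
  by apply/vle_sub_ge0; apply: vle_trans (ycd i0).1 (ycd i0).2.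
have /cvgrPdist_le/(_ _ e20) h := yl _ cd0.
exists [set i | `|vmeet (vabs (y i - l)) (d - c)| <= e / 2].
  by apply: filterS h => i; rewrite sub0r normrN normr_id.
move=> i j /= hi hj.
suff le : `|y i - y j| <= `|vmeet (vabs (y i - l)) (d - c) +
                            vmeet (vabs (y j - l)) (d - c)|.
  by apply: le_trans le _; apply: le_trans (ler_normD _ _) _; lra.
apply: norm_vabs_le.
have := vmeet_addl_le (vabs_ge0 (y i - l)) (vabs_ge0 (y j - l)) cd0.
apply: vle_trans; apply: vle_meet.
  have -> : y i - y j = (y i - l) + - (y j - l) by vec R.
  by rewrite -(vabsN (y j - l)); exact: vabs_add.
have [ci di] := ycd i; have [cj dj] := ycd j.
by apply: vabs_le; [apply: (vle_by2 di cj)|apply: (vle_by2 dj ci)]; vec R.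
Qed.

Lemma un_cvg_norm (I : Type) (G : set_system I) (y : I -> F) (l : F) :
  Filter G -> (fun i => `|y i - l|) @ G --> (0 : R) -> un_cvg G y l.
Proof.
move=> FG /cvgrPdist_le yl u u0; apply/cvgrPdist_le => e /yl.
apply: filterS => i; rewrite !sub0r !normrN !normr_id; apply: le_trans.
rewrite -(norm_vabs (y i - l)); apply: norm_vle; last exact: vmeet_lel.
by apply: vmeet_ge0 => //; exact: vabs_ge0.
Qed.

Lemma invS_small (e : R) : 0 < e -> exists n : nat, n.+1%:R^-1 <= e.
Proof.
move=> e0; exists (Num.truncn e^-1).
by rewrite invf_ple ?posrE //; apply/ltW/truncnS_gt.
Qed.

Lemma le_invS (m n : nat) : (m <= n)%N -> n.+1%:R^-1 <= m.+1%:R^-1 :> R.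
Proof. by move=> mn; rewrite lef_pV2 ?posrE // ler_nat. Qed.

Lemma totally_bounded_un_compact A : totally_bounded A -> un_compact A.
Proof.
move=> Atb D y yA.
have [|l lP] := @totally_bounded_cluster A (y @ @tails D) Atb _.
  by have [a] := directed_inh D; exists a => b _; exact: yA.
have near_l a (n : nat) : exists2 b, dle a b & `|y b - l| <= n.+1%:R^-1.
  have n0 : 0 < n.+1%:R^-1 :> R by rewrite invr_gt0.
  have [|_ [b ab <-] h] := lP _ [set y b | b in [set b | dle a b]] n0.
    by exists a => b ab; exists b.
  by exists b.
pose D' := {p : D * nat | `|y p.1 - l| <= p.2.+1%:R^-1}.
pose le (p q : D') :=
  dle (sval p).1 (sval q).1 /\ ((sval p).2 <= (sval q).2)%N.
have le_refl p : le p p by split; [exact: dle_refl|exact: leqnn].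
have le_tr p q r : le p q -> le q r -> le p r.
  move=> [pq1 pq2] [qr1 qr2].
  by split; [exact: dle_trans pq1 qr1|exact: leq_trans pq2 qr2].
have le_dir p q : exists r, le p r /\ le q r.
  have [a [pa qa]] := directed_ub (sval p).1 (sval q).1.
  have [b ab hb] := near_l a (maxn (sval p).2 (sval q).2).
  exists (exist _ (b, _) hb); split; split => /=.
  - exact: dle_trans pa ab.
  - exact: leq_maxl.
  - exact: dle_trans qa ab.
  - exact: leq_maxr.
have D'inh : inhabited D'.
  have [a] := directed_inh D; have [b ab hb] := near_l a 0%N.
  exact: (inhabits (exist _ (b, 0%N) hb)).
exists (DirectedSet le_refl le_tr le_dir D'inh).
exists (fun p => (sval p).1), l; split.
  move=> a; have [b ab hb] := near_l a 0%N.
  exists (exist _ (b, 0%N) hb) => q [bq _]; exact: dle_trans ab bq.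
apply: un_cvg_norm; apply/cvgrPdist_le => e /invS_small[n ne].
have [a] := directed_inh D; have [b ab hb] := near_l a n.
exists (exist _ (b, n) hb) => -[[c k] /= hc] [_ /= nk].
rewrite sub0r normrN normr_id; apply: le_trans hc _.
exact: le_trans (le_invS nk) ne.
Qed.

Lemma totally_bounded_sigma_un_compact A :
  totally_bounded A -> sigma_un_compact A.
Proof.
move=> Atb y yA.
have [|l lP] := @totally_bounded_cluster A (y @ \oo) Atb _.
  by exists 0%N => // n _; exact: yA.
have /choice[f fP] : forall p : nat * nat, exists m, (p.1 < m)%N /\
    `|y m - l| <= p.2.+1%:R^-1.
  move=> [a n] /=; have n0 : 0 < n.+1%:R^-1 :> R by rewrite invr_gt0.
  have [|_ [b ab <-] h] := lP _ [set y b | b in [set b | (a < b)%N]] n0.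
    by exists a.+1 => // b ab; exists b.
  by exists b.
pose phi := fix phi n := if n is m.+1 then f (phi m, n) else f (0%N, 0%N).
exists phi, l; split.
  apply: homo_ltn; first exact: ltn_trans.
  by move=> n; exact: (fP (phi n, n.+1)).1.
apply: un_cvg_norm; apply/cvgrPdist_le => e /invS_small[n ne].
exists n => // -[|m] /= nm; rewrite sub0r normrN normr_id.
  apply: le_trans (fP (0%N, 0%N)).2 _; exact: le_trans (le_invS nm) ne.
apply: le_trans (fP (phi m, m.+1)).2 _; exact: le_trans (le_invS nm) ne.
Qed.

Lemma un_compact_totally_bounded A (c d : F) :
  A `<=` ointerval c d -> un_compact A -> totally_bounded A.
Proof.
move=> Acd Aun; apply: contrapT => /not_totally_bounded[e [y [e0 yA ysep]]].
have le_dir (m n : nat) : exists k, (m <= k)%N /\ (n <= k)%N.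
  by exists (maxn m n); rewrite leq_maxl leq_maxr.
have leq_tr (m n p : nat) : (m <= n)%N -> (n <= p)%N -> (m <= p)%N.
  exact: leq_trans.
pose D := DirectedSet leqnn leq_tr le_dir (inhabits 0%N).
have [D' [phi [l [phiP yl]]]] := Aun D y yA.
have ycd i : ointerval c d ((y \o phi) i) by apply: Acd; exact: yA.
have [P [a aP] hP] := un_cvg_cauchy _ ycd yl e0.
have [b bP] := phiP (phi a).+1; have [c' [ac bc]] := directed_ub a b.
have := hP c' a (aP _ ac) (aP _ (dle_refl a)).
by rewrite leNgt => /negP; apply; apply: ysep; exact: bP.
Qed.

Lemma sigma_un_compact_totally_bounded A (c d : F) :
  A `<=` ointerval c d -> sigma_un_compact A -> totally_bounded A.
Proof.
move=> Acd Aun; apply: contrapT => /not_totally_bounded[e [y [e0 yA ysep]]].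
have [phi [l [phi_lt yl]]] := Aun y yA.
have ycd i : ointerval c d ((y \o phi) i) by apply: Acd; exact: yA.
have [P [n _ nP] hP] := un_cvg_cauchy _ ycd yl e0.
have := hP n.+1 n (nP _ (leqnSn n)) (nP _ (leqnn n)).
rewrite leNgt => /negP; apply; apply: ysep; exact: phi_lt.
Qed.

End TotallyBounded.

(** * Automatic continuity of order bounded operators *)

(** If vectors x_n of the unit ball had images growing like 4^n, then all 2^-n x_n would lie
    in one order interval, given by the sum of the absolutely convergent series
    of the 2^-n |x_n|, although their images are unbounded. *)
Lemma order_bounded_continuous (R : realType) (E F : banachLatticeType R)
  (T : E -> F) : linear T -> order_bounded T -> continuous T.
Proof.
move=> Tl Tb.
have [M MP] : exists M : R, forall x, `|x| <= 1 -> `|T x| <= M.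
  apply: contrapT => /forallNP nM.
  have /choice[x xP] : forall n : nat, exists x, `|x| <= 1 /\ 4 ^+ n < `|T x|.
    move=> n; have /existsNP[x /not_implyP[x1 Tx]] := nM (4 ^+ n).
    by exists x; split=> //; rewrite ltNge; apply/negP.
  pose u n : E := 2^-1 ^+ n *: vabs (x n).
  have h0 n : 0 <= 2^-1 ^+ n :> R by apply: exprn_ge0; rewrite invr_ge0.
  have u0 n : 0 <=v u n by apply: vle_scale => //; exact: vabs_ge0.
  have : cvgn (series u).
    apply: normed_cvg; apply: series_le_cvg (is_cvg_geometric_series _).
    - by move=> n; exact: normr_ge0.
    - by move=> n; exact: (@geometric_ge0 R 1 (2^-1) n).
    - move=> n /=; rewrite /u normrZ ger0_norm // norm_vabs /geometric /= mul1r.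
      by rewrite ler_piMr //; exact: (xP n).1.
    - by rewrite ger0_norm ?invr_ge0 //; lra.
  set w := limn _ => uw.
  have uw_le n : u n <=v w.
    have s_le m k : series u m <=v series u (m + k)%N.
      elim: k => [|k ihk]; first by rewrite addn0; exact: vle_refl.
      rewrite addnS seriesSr; apply: (vle_by2 ihk (u0 (m + k)%N)); vec R.
    have s_ge0 m : 0 <=v series u m.
      by have := s_le 0%N m; rewrite add0n /series /= big_geq.
    apply/vle_sub_ge0; apply: positive_cone_closed => e e0.
    have /cvgrPdist_le/(_ _ e0)[m _ mP] := uw.
    exists (series u (n.+1 + m)%N - u n).
      by apply/vle_sub_ge0; apply: vle_trans (s_le _ m); rewrite seriesSr;
        apply: (vle_by1 (s_ge0 n)); vec R.
    have := mP (n.+1 + m)%N (leq_addl _ _); rewrite distrC; apply: le_trans.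
    have -> // : series u (n.+1 + m)%N - u n - (w - u n) =
       series u (n.+1 + m)%N - w by vec R.
  have [c [d cd]] := Tb (- w) w.
  pose K := `|vabs c + vabs d|.
  have KP y : ointerval c d y -> `|y| <= K.
    move=> [cy yd]; apply: norm_vabs_le; apply: vabs_le.
      apply: (vle_by2 yd (vge0_add (vabs_ge0 c) _)).
        by apply/vle_sub_ge0; exact: (vle_abs d).
      by vec R.
    apply: (vle_by2 cy (vge0_add (vabs_ge0 d) _)).
      by apply/vle_sub_ge0; exact: (vleN_abs c).
    by vec R.
  pose n := (Num.truncn K).+1.
  have nw : ointerval (- w) w (2^-1 ^+ n *: x n).
    split; apply: (vle_by2 (uw_le n) (vle_scale2 (h0 n) _)).
    - exact: (vleN_abs (x n)).
    - by rewrite /u; vec R.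
    - exact: (vle_abs (x n)).
    - by rewrite /u; vec R.
  have := KP _ (cd _ (imageP _ nw)).
  rewrite leNgt => /negP; apply; apply: (lt_le_trans (truncnS_gt _)).
  rewrite (linZ Tl) normrZ ger0_norm //.
  apply: (@le_trans _ _ (2^-1 ^+ n * 4 ^+ n)); last first.
    by apply: ler_wpM2l => //; exact/ltW/(xP n).2.
  rewrite -exprMn; have -> : 2^-1 * 4 = 2 :> R by lra.
  by rewrite -natrX ler_nat; exact/ltnW/ltn_expl.
have TM z : `|T z| <= M * `|z|.
  have [->|z0] := eqVneq z 0.
    by rewrite (lin0 Tl) !normr0 mulr0.
  have nz : 0 < `|z| by rewrite normr_gt0.
  have := MP (`|z|^-1 *: z).
  rewrite (linZ Tl) !normrZ ger0_norm ?invr_ge0 // mulVf ?gt_eqF //.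
  move=> /(_ (lexx _)).
  by rewrite mulrC ler_pdivrMr.
move=> a; apply/cvgrPdist_le => e e0.
have M1 : 0 < `|M| + 1 by have := normr_ge0 M; lra.
near=> x; rewrite -(linB Tl).
apply: le_trans (TM _) _; apply: (@le_trans _ _ ((`|M| + 1) * `|a - x|)).
  by apply: ler_wpM2r => //; have := ler_norm M; lra.
rewrite mulrC -ler_pdivlMr //; near: x.
by apply: cvgr_dist_le; [exact: cvg_id|rewrite divr_gt0].
Unshelve. all: by end_near. Qed.

(** * The vector lattice of order bounded operators *)

Section Operators.
Variables (R : realType) (E F : banachLatticeType R).
Implicit Types (S T U : Lb E F) (x y : E).

Lemma Lb_lin T : linear T. Proof. exact: (LbP T).1. Qed.

Lemma Lb_addE S T x : (S + T) x = S x + T x. Proof. by []. Qed.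
Lemma Lb_oppE T x : (- T) x = - T x. Proof. by []. Qed.
Lemma Lb_scaleE (k : R) T x : (k *: T) x = k *: T x. Proof. by []. Qed.
Lemma Lb_zeroE x : (0 : Lb E F) x = 0. Proof. by []. Qed.

(** A linear map above an order bounded one differs from it by a positive map,
    which is monotone. *)
Lemma Lb_of_linear (f : E -> F) S : linear f ->
  (forall x, 0 <=v x -> S x <=v f x) -> exists T, forall x, T x = f x.
Proof.
move=> fl Sf; suff fP : f \in Lb_pred (E := E) (F := F) by exists (MkLb fP).
apply/asboolP; split => // a b; have [c [d Scd]] := (LbP S).2 a b.
have fm x y : x <=v y -> f x - S x <=v f y - S y.
  move=> /vle_sub_ge0 xy; have h := Sf _ xy.
  rewrite (linB fl) (linB (Lb_lin S)) in h.
  by apply: (vle_by1 h); vec R.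
exists (c + (f a - S a)), (d + (f b - S b)) => _ [x [ax xb] <-].
have [cS Sd] := Scd _ (imageP S (conj ax xb)).
split; [apply: (vle_by2 cS (fm _ _ ax))|apply: (vle_by2 Sd (fm _ _ xb))]; vec R.
Qed.

Lemma Lb_pos_mono T x y : 0 <=v T -> x <=v y -> T x <=v T y.
Proof. by move=> T0; apply: pos_mono; [exact: Lb_lin|exact: T0]. Qed.

(** [partition_sum S T x z]: z is the sum of the S x_i \/ T x_i over some
    partition of x into positive vectors x_i.  The inductive form, by successive
    splittings, replaces the bookkeeping of common refinements. *)
Inductive partition_sum S T : E -> F -> Prop :=
  | psum_leaf x : 0 <=v x -> partition_sum S T x (vjoin (S x) (T x))
  | psum_node x y z w : partition_sum S T x z -> partition_sum S T y w ->
      partition_sum S T (x + y) (z + w).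

Lemma psum_ge0 S T x z : partition_sum S T x z -> 0 <=v x.
Proof. by elim=> // *; exact: vge0_add. Qed.

Lemma psum_ge S T x z : partition_sum S T x z -> vjoin (S x) (T x) <=v z.
Proof.
elim=> [y _|a b v w _ hv _ hw]; first exact: vle_refl.
rewrite !(linD (Lb_lin _)); apply: vjoin_le; apply: vle_add.
- exact: vle_trans (vle_joinl _ _) hv.
- exact: vle_trans (vle_joinl _ _) hw.
- exact: vle_trans (vle_joinr _ _) hv.
- exact: vle_trans (vle_joinr _ _) hw.
Qed.

Lemma psum_split S T x z a b : partition_sum S T x z ->
  0 <=v a -> 0 <=v b -> x = a + b ->
  exists v w, [/\ partition_sum S T a v, partition_sum S T b w & z <=v v + w].
Proof.
move=> h; elim: h a b => [y _|x1 x2 z1 z2 h1 ih1 h2 ih2] a b a0 b0 xab.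
  exists (vjoin (S a) (T a)), (vjoin (S b) (T b)).
  split; try exact: psum_leaf.
  rewrite xab !(linD (Lb_lin _)); apply: vjoin_le; apply: vle_add;
    (exact: vle_joinl || exact: vle_joinr).
have [a1 [b1 [a2 [b2 [[e1 e2 ea eb] [a10 b10 a20 b20]]]]]] :=
  riesz_refinement (psum_ge0 h1) (psum_ge0 h2) a0 b0 xab.
have [v1 [w1 [va1 wb1 le1]]] := ih1 _ _ a10 b10 e1.
have [v2 [w2 [va2 wb2 le2]]] := ih2 _ _ a20 b20 e2.
exists (v1 + v2), (w1 + w2); rewrite ea eb; split.
- exact: psum_node.
- exact: psum_node.
- by apply: (vle_by2 le1 le2); vec R.
Qed.

Lemma psum_directed S T x : directed_up (partition_sum S T x).
Proof.
move=> z w hz; elim: hz w => [y y0|x1 x2 z1 z2 h1 ih1 h2 ih2] w hw.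
  by exists w; split => //; [exact: psum_ge|exact: vle_refl].
have [w1 [w2 [hw1 hw2 le]]] := psum_split hw (psum_ge0 h1) (psum_ge0 h2) erefl.
have [v1 [hv1 zv1 wv1]] := ih1 _ hw1; have [v2 [hv2 zv2 wv2]] := ih2 _ hw2.
exists (v1 + v2); split.
- exact: psum_node.
- exact: vle_add.
- exact: vle_trans le (vle_add wv1 wv2).
Qed.

Lemma psum_le S T U x z : (S : Lb E F) <=v U -> (T : Lb E F) <=v U ->
  partition_sum S T x z -> z <=v U x.
Proof.
move=> SU TU; elim=> [y y0|a b v w _ hv _ hw].
  by apply: vjoin_le; [exact: SU|exact: TU].
by rewrite (linD (Lb_lin _)); exact: vle_add.
Qed.

(** Choosing S or T on each piece of a partition amounts to splitting x as
    y + (x - y).  The values S y + T (x - y) lie in an order bounded set, whereas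
    the number of pieces is not controlled. *)
Lemma psum_le_split S T x z : partition_sum S T x z -> forall u,
  (forall y, 0 <=v y -> y <=v x -> S y + T (x - y) <=v u) -> z <=v u.
Proof.
elim=> [y y0|a b v w ha iha hb ihb] u hu.
  apply: vjoin_le.
    have := hu y y0 (vle_refl _).
    by rewrite subrr (lin0 (Lb_lin T)) addr0.
  have := hu 0 (vle_refl _) y0.
  by rewrite subr0 (lin0 (Lb_lin S)) add0r.
suff h : v <=v u - w by apply: (vle_by1 h); vec R.
apply: iha => y1 y10 y1a.
suff h : w <=v u - (S y1 + T (a - y1)) by apply: (vle_by1 h); vec R.
apply: ihb => y2 y20 y2b.
have := hu _ (vge0_add y10 y20) (vle_add y1a y2b).
rewrite !(linB (Lb_lin _)) !(linD (Lb_lin _)) => h.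
by apply: (vle_by1 h); vec R.
Qed.

Lemma psum_scale S T (k : R) x z : 0 < k ->
  partition_sum S T x z -> partition_sum S T (k *: x) (k *: z).
Proof.
move=> k0; elim=> [y y0|a b v w _ ha _ hb]; last first.
  by rewrite !scalerDr; exact: psum_node.
have -> : k *: vjoin (S y) (T y) = vjoin (S (k *: y)) (T (k *: y)).
  rewrite !(linZ (Lb_lin _)); apply: vle_anti.
    by apply/vle_pscalel => //; apply: vjoin_le; apply/vle_pscalel => //;
      (exact: vle_joinl || exact: vle_joinr).
  by apply: vjoin_le; apply: vle_scale2; try exact: ltW;
    (exact: vle_joinl || exact: vle_joinr).
by apply: psum_leaf; apply: vle_scale => //; exact: ltW.
Qed.

Hypothesis Fc : directed_complete F.

(** The Riesz-Kantorovich formula, with partitions into any number of pieces: in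
    this form the supremum is that of a directed set, so that it is approximated
    in norm by single partitions. *)
Lemma Lb_join S T : exists J : Lb E F,
  is_sup [set S; T] J /\
  forall x, 0 <=v x -> is_sup (partition_sum S T x) (J x).
Proof.
have [||||||G [Gl GP]] := @linear_sup R E F (partition_sum S T) Fc.
- by move=> x x0; exists (vjoin (S x) (T x)); exact: psum_leaf.
- by move=> x _; exact: psum_directed.
- move=> x x0; have [c [d Scd]] := (LbP S).2 0 x.
  have [c' [d' Tcd]] := (LbP T).2 0 x.
  exists (d + d') => z /psum_le_split; apply => y y0 yx; apply: vle_add.
    exact: (Scd _ (imageP S (conj y0 yx))).2.
  apply: (Tcd _ (imageP T _)).2; split; first exact/vle_sub_ge0.
  by apply: (vle_by1 y0); vec R.
- move=> x y v w _ _ hv hw; exists (v + w); last exact: vle_refl.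
  exact: psum_node.
- by move=> x y z x0 y0 hz; exact: psum_split hz x0 y0 erefl.
- by move=> k x v k0 _; exact: psum_scale.
have GS x : 0 <=v x -> S x <=v G x.
  move=> x0; apply: vle_trans (vle_joinl _ (T x)) _.
  by apply: (GP _ x0).1; exact: psum_leaf.
have GT x : 0 <=v x -> T x <=v G x.
  move=> x0; apply: vle_trans (vle_joinr (S x) _) _.
  by apply: (GP _ x0).1; exact: psum_leaf.
have [J JE] := Lb_of_linear Gl GS; exists J; split; last first.
  by move=> x; rewrite JE; exact: GP.
split=> [_ [|] -> x x0|U Uub x x0]; rewrite JE; [exact: GS|exact: GT|].
apply: (GP _ x0).2 => z; apply: psum_le; apply: Uub; [by left|by right].
Qed.

Lemma Lb_vector_lattice : vector_lattice (Lb E F).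
Proof. by move=> S T; have [J [JP _]] := Lb_join S T; exists J. Qed.

(** The pointwise supremum is linear by [linear_sup], and the order between
    operators is the pointwise order on the positive cone. *)
Lemma Lb_directed_sup (A : set (Lb E F)) (b : Lb E F) :
  A !=set0 -> directed_up A -> (forall T, A T -> T <=v b) ->
  exists2 m : Lb E F, is_sup A m &
    forall x, 0 <=v x -> is_sup [set (T : Lb E F) x | T in A] (m x).
Proof.
move=> [T0 AT0] Adir Ab.
have [||||||G [Gl GP]] :=
  @linear_sup R E F (fun x => [set (T : Lb E F) x | T in A]) Fc.
- by move=> x _; exists (T0 x), T0.
- move=> x x0 _ _ [S AS <-] [T AT <-]; have [U [AU SU TU]] := Adir _ _ AS AT.
  by exists (U x); split; [exists U|exact: SU|exact: TU].
- by move=> x x0; exists (b x) => _ [T AT <-]; exact: Ab.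
- move=> x y _ _ x0 y0 [S AS <-] [T AT <-].
  have [U [AU SU TU]] := Adir _ _ AS AT.
  exists (U (x + y)); first by exists U.
  by rewrite (linD (Lb_lin U)); apply: vle_add; [exact: SU|exact: TU].
- move=> x y _ x0 y0 [T AT <-]; exists (T x), (T y).
  by split; [exists T|exists T|rewrite (linD (Lb_lin T)); exact: vle_refl].
- by move=> k x _ k0 x0 [T AT <-]; exists T => //; rewrite (linZ (Lb_lin T)).
have GA T x : A T -> 0 <=v x -> T x <=v G x.
  by move=> AT x0; apply: (GP _ x0).1; exists T.
have [m mE] := Lb_of_linear Gl (fun x xpos => GA _ _ AT0 xpos).
exists m; last by move=> x; rewrite mE; exact: GP.
split=> [T AT x x0|U Uub x x0]; rewrite mE; first exact: GA.
by apply: (GP _ x0).2 => _ [T AT <-]; exact: Uub.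
Qed.

Lemma Lb_directed_complete : directed_complete (Lb E F).
Proof.
move=> A b A0 Adir Ab.
by have [m mA _] := Lb_directed_sup A0 Adir Ab; exists m.
Qed.

End Operators.

(** * The band of AM-compact operators *)

Section AMCompact.
Variables (R : realType) (E F : banachLatticeType R).
Implicit Types (S T U : Lb E F).

(** In the Banach space F this is relative compactness of the images of order
    intervals; positive intervals fit the Riesz decomposition property. *)
Definition AM_compact T :=
  forall x, 0 <=v x -> totally_bounded (T @` ointerval 0 x).

Lemma AM_compact_approx S :
  (forall x (e : R), 0 <=v x -> 0 < e -> exists2 T, AM_compact T &
     forall y, ointerval 0 x y -> `|S y - T y| <= e) ->
  AM_compact S.
Proof.
move=> h x x0; apply: totally_bounded_approx => e e0.
have [T Tc ST] := h _ _ x0 e0; exists (T @` ointerval 0 x); first exact: Tc.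
by move=> _ [y yx <-]; exists (T y); [exact: imageP|exact: ST].
Qed.

Lemma AM_compact0 : AM_compact 0.
Proof.
move=> x _ e e0; exists [:: 0] => _ [y _ <-]; exists 0; rewrite ?mem_head //.
by rewrite Lb_zeroE subr0 normr0 ltW.
Qed.

Lemma AM_compact_lin (k : R) S T :
  AM_compact S -> AM_compact T -> AM_compact (k *: S + T).
Proof.
move=> Sc Tc x x0; have k1 : 0 < `|k| + 1 by have := normr_ge0 k; lra.
have kS : totally_bounded ((fun z => k *: z) @` (S @` ointerval 0 x)).
  apply: totally_bounded_lipschitz k1 _ (Sc _ x0) => y z.
  by rewrite -scalerBr normrZ; apply: ler_wpM2r => //; lra.
apply: totally_bounded_sub (totally_bounded_add kS (Tc _ x0)).
move=> _ [y yx <-] /=; exists (k *: S y).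
  by exists (S y) => //; exists y.
by exists (T y) => //; exists y.
Qed.

Lemma AM_compactD S T : AM_compact S -> AM_compact T -> AM_compact (S + T).
Proof. by move=> Sc Tc; rewrite -[S]scale1r; exact: AM_compact_lin. Qed.

Lemma AM_compactZ (k : R) S : AM_compact S -> AM_compact (k *: S).
Proof.
by move=> Sc; rewrite -[_ *: _]addr0; apply: AM_compact_lin => //;
  exact: AM_compact0.
Qed.

Lemma AM_compactB S T : AM_compact S -> AM_compact T -> AM_compact (S - T).
Proof.
move=> Sc Tc; apply: AM_compactD => //.
by rewrite -scaleN1r; exact: AM_compactZ.
Qed.

(** Each y in [-x, x] is the difference of y^+ and y^-, which lie in [0, x]. *)
Lemma AM_compact_symmetric T x : AM_compact T -> 0 <=v x ->
  totally_bounded (T @` ointerval (- x) x).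
Proof.
move=> Tc x0; have NTc : AM_compact (0 - T).
  by apply: AM_compactB => //; exact: AM_compact0.
apply: totally_bounded_sub (totally_bounded_add (Tc _ x0) (NTc _ x0)).
move=> _ [y [xy yx] <-]; exists (T (vpos y)).
  exists (vpos y) => //; split; first exact: vpos_ge0.
  exact: vjoin_le.
exists ((0 - T) (vpos (- y))).
  exists (vpos (- y)) => //; split; first exact: vpos_ge0.
  by apply: vjoin_le => //; apply: (vle_by1 xy); vec R.
rewrite Lb_addE Lb_oppE Lb_zeroE add0r -(linB (Lb_lin T)).
by rewrite vposBneg.
Qed.

(** The images of order intervals lie in order intervals, where un-compactness
    amounts to total boundedness. *)
Lemma AM_un_compactP T : AM_un_compact T <-> AM_compact T.
Proof.
split=> [[_ _ Tun] x x0|Tc].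
  have [c [d cd]] := (LbP T).2 (- x) x.
  apply: totally_bounded_sub (un_compact_totally_bounded cd (Tun _ x0)).
  move=> _ [y [y0 yx] <-]; apply: imageP; split => //.
  by apply: (vle_by2 y0 x0); vec R.
split; first exact: Lb_lin.
  exact: order_bounded_continuous (LbP T).1 (LbP T).2.
move=> x x0; apply: totally_bounded_un_compact.
exact: AM_compact_symmetric.
Qed.

Lemma AM_sigma_un_compactP T : AM_sigma_un_compact T <-> AM_compact T.
Proof.
split=> [[_ _ Tun] x x0|Tc].
  have [c [d cd]] := (LbP T).2 (- x) x.
  apply: totally_bounded_sub (sigma_un_compact_totally_bounded cd (Tun _ x0)).
  move=> _ [y [y0 yx] <-]; apply: imageP; split => //.
  by apply: (vle_by2 y0 x0); vec R.
split; first exact: Lb_lin.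
  exact: order_bounded_continuous (LbP T).1 (LbP T).2.
move=> x x0; apply: totally_bounded_sigma_un_compact.
exact: AM_compact_symmetric.
Qed.

Hypothesis hF : order_continuous_norm F.
Let Fc : directed_complete F := order_continuous_directed_complete hF.

(** On a piece x of a partition, the projection P onto the band where
    S1 x >= S2 x nearly separates the two operators: S1 - P (S1 + s S2) is
    bounded on [0, x] by (1 - P) S1 x + P S2 x = S1 x + S2 x - (S1 x \/ S2 x).
    These errors add up over the partition.  The sign s = -1 serves for the parts
    of an operator T^+ - T^-, and s = 1 for a component and its complement. *)
Lemma psum_approx S1 S2 (s : R) x z : s = 1 \/ s = -1 ->
  0 <=v S1 -> 0 <=v S2 -> AM_compact (S1 + s *: S2) ->
  partition_sum S1 S2 x z ->
  exists2 K : set F, totally_bounded K & forall y, ointerval 0 x y ->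
    exists2 k, K k & vabs (S1 y - k) <=v S1 x + S2 x - z.
Proof.
move=> s1 S10 S20 Sc; elim=> [a a0|a b v w ha [K Kt KP] hb [L Lt LP]].
  pose f := S1 a - S2 a.
  have [P [PP _ Pp Pn]] := band_projection f Fc; have [Pl Pb] := PP.
  exists (P @` ((S1 + s *: S2) @` ointerval 0 a)).
    apply: totally_bounded_lipschitz ltr01 _ (Sc _ a0) => p q.
    rewrite mul1r -(linB Pl); apply: lattice_norm.
    exact: projection_like_vabs.
  move=> y [y0 ya]; exists (P ((S1 + s *: S2) y)).
    by exists ((S1 + s *: S2) y) => //; exists y.
  have PS1 : 0 <=v S1 y - P (S1 y).
    by apply/vle_sub_ge0; exact: (Pb _ (S10 _ y0)).2.
  have PS2 : 0 <=v P (S2 y) := (Pb _ (S20 _ y0)).1.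
  have h : vabs (S1 y - P ((S1 + s *: S2) y)) <=v S1 y - P (S1 y) + P (S2 y).
    rewrite Lb_addE Lb_scaleE (linD Pl) (linZ Pl).
    case: s1 => ->; apply: vabs_le;
      first [by apply: (vle_by2 PS1 PS1); vec R
            |by apply: (vle_by2 PS2 PS2); vec R
            |by apply: (vle_by2 (vge0_add PS1 PS1) (vge0_add PS2 PS2)); vec R
            |by apply: (vle_by1 (vle_refl 0)); vec R].
  apply: vle_trans h _.
  have ay : 0 <=v a - y by apply/vle_sub_ge0.
  have D1 := (Pb _ (S10 _ ay)).2; have D2 := (Pb _ (S20 _ ay)).1.
  rewrite !(linB (Lb_lin _)) !(linB Pl) in D1 D2.
  have Pf : P (S1 a) - P (S2 a) = vpos f.
    by rewrite -(linB Pl) -/f -{1}(vposBneg f) (linB Pl) Pp Pn subr0.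
  rewrite vjoinE -/f -Pf.
  by apply: (vle_by2 D1 D2); vec R.
exists [set k + l | k in K & l in L]; first exact: totally_bounded_add.
move=> y [y0 yab].
have [y1 [y2 [-> y10 y1a y20 y2b]]] :=
  riesz_decomposition y0 (psum_ge0 ha) (psum_ge0 hb) yab.
have [k Kk hk] := KP _ (conj y10 y1a); have [l Ll hl] := LP _ (conj y20 y2b).
exists (k + l); first by exists k => //; exists l.
rewrite !(linD (Lb_lin _)).
have -> : S1 y1 + S1 y2 - (k + l) = (S1 y1 - k) + (S1 y2 - l) by vec R.
apply: vle_trans (vabs_add _ _) _.
by apply: (vle_by2 hk hl); vec R.
Qed.

(** Disjointness of S1 and S2 means that S1 + S2 is their supremum, so that the
    partition errors can be made small in norm. *)
Lemma AM_compact_disjoint S1 S2 (s : R) : s = 1 \/ s = -1 ->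
  0 <=v S1 -> 0 <=v S2 -> is_sup [set S1; S2] (S1 + S2) ->
  AM_compact (S1 + s *: S2) -> AM_compact S1.
Proof.
move=> s1 S10 S20 dis Sc x x0; apply: totally_bounded_approx => e e0.
have [J [JP Jx]] := Lb_join Fc S1 S2; have JE := is_sup_uniq JP dis.
have A0 : partition_sum S1 S2 x !=set0.
  by exists (vjoin (S1 x) (S2 x)); exact: psum_leaf.
have [z hz ze] :=
  directed_sup_approx hF A0 (@psum_directed _ _ _ S1 S2 x) (Jx _ x0) e0.
have [K Kt KP] := psum_approx s1 S10 S20 Sc hz.
exists K => // _ [y yx <-]; have [k Kk hk] := KP _ yx; exists k => //.
by apply: le_trans ze; rewrite JE Lb_addE; exact: norm_vabs_le.
Qed.

Lemma AM_compact_pos_part T : AM_compact T ->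
  exists p n : Lb E F, [/\ T = p - n, 0 <=v p, 0 <=v n, AM_compact p &
    is_sup [set T; 0] p].
Proof.
move=> Tc; have [p [n [TE p0 n0 dis pP]]] := riesz_transfer
  (Q := fun V => forall f : V, exists p n : V, [/\ f = p - n, 0 <=v p, 0 <=v n,
     is_sup [set p; n] (p + n) & is_sup [set f; 0] p])
  (Lb_vector_lattice Fc) (@pos_part R) T.
exists p, n; split => //; apply: AM_compact_disjoint p0 n0 dis _.
  by right; reflexivity.
by rewrite scaleN1r -TE.
Qed.

(** Every S between 0 and T is the limit of its dyadic expansion in components of
    T, and components of T are disjoint from their complements. *)
Lemma AM_compact_dominated S T : 0 <=v S -> S <=v T -> AM_compact T ->
  AM_compact S.
Proof.
move=> S0 ST Tc.
have approx n : forall S T, 0 <=v S -> S <=v T -> AM_compact T ->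
    exists C : Lb E F, [/\ AM_compact C, C <=v S & S - C <=v 2^-1 ^+ n *: T].
  elim: n => [|n ihn] {S0 ST Tc} {}S {}T S0 ST Tc.
    by exists 0; split; [exact: AM_compact0|exact: S0|rewrite scale1r subr0].
  have [C [C0 CT dis CS SC]] := riesz_transfer
    (Q := fun V => forall s t : V, directed_complete V -> 0 <=v s -> s <=v t ->
      exists c : V, [/\ 0 <=v c, c <=v t, is_sup [set c; t - c] t,
        2^-1 *: c <=v s & s - 2^-1 *: c <=v 2^-1 *: t])
    (Lb_vector_lattice Fc) (@half_component R) S T
    (Lb_directed_complete Fc) S0 ST.
  have CDE : C + (T - C) = T by vec R.
  have Cc : AM_compact C.
    apply: (@AM_compact_disjoint C (T - C) 1).
    - by left.
    - exact: C0.
    - exact/vle_sub_ge0.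
    - by rewrite CDE.
    - by rewrite scale1r CDE.
  have S'0 : 0 <=v S - 2^-1 *: C by apply/vle_sub_ge0.
  have [C' [C'c C'S SC']] := ihn _ _ S'0 SC (AM_compactZ 2^-1 Tc).
  exists (2^-1 *: C + C'); split.
  - exact: AM_compact_lin.
  - by apply: (vle_by1 C'S); vec R.
  - have -> : 2^-1 ^+ n.+1 *: T = 2^-1 ^+ n *: (2^-1 *: T).
      by rewrite exprSr scalerA.
    by apply: (vle_by1 SC'); vec R.
apply: AM_compact_approx => x e x0 e0.
have [n ne] : exists n, 2^-1 ^+ n * `|T x| <= e.
  pose n := (Num.truncn (`|T x| / e)).+1; exists n.
  have : `|T x| / e < 2 ^+ n.
    apply: lt_trans (truncnS_gt _) _.
    by rewrite -natrX ltr_nat; exact: ltn_expl.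
  rewrite ltr_pdivrMr // => h.
  by rewrite exprVn mulrC ler_pdivrMr ?exprn_gt0 // mulrC ltW.
have [C [Cc CS SC]] := approx n S T S0 ST Tc.
exists C => // y [y0 yx]; apply: le_trans ne.
rewrite -[X in X * _]ger0_norm ?exprn_ge0 ?invr_ge0 // -normrZ.
apply: norm_vle; first by apply/vle_sub_ge0; exact: CS.
apply: vle_trans (SC y y0) _.
have := vle_scale2 (k := 2^-1 ^+ n) _ (Lb_pos_mono (vle_trans _ _ _ S0 ST) yx).
by apply; rewrite exprn_ge0 ?invr_ge0.
Qed.

Lemma AM_compact_solid : solid [set T : Lb E F | AM_compact T].
Proof.
move=> v w mv mw [vmv _] [_ wmw] mvw /= wc.
have [p [n [wE p0 n0 pc _]]] := AM_compact_pos_part wc.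
pose U : Lb E F := p + p - w.
have Uc : AM_compact U by apply: AM_compactB => //; exact: AM_compactD.
have mwU : mw <=v U.
  apply: wmw => _ [|] ->; rewrite /U wE.
    by apply: (vle_by2 n0 n0); vec R.
  by apply: (vle_by2 p0 p0); vec R.
have mvU := vle_trans _ _ _ mvw mwU.
have vU : v <=v U by apply: vle_trans mvU; apply: vmv; left.
have vNU : - v <=v U by apply: vle_trans mvU; apply: vmv; right.
have -> : v = (v + U) - U by vec R.
apply: AM_compactB => //; apply: (@AM_compact_dominated _ (U + U)).
- by apply: (vle_by1 vNU); vec R.
- by apply: (vle_by1 vU); vec R.
- exact: AM_compactD.
Qed.

(** The finite joins of elements of A: a directed set with the same upper
    bounds. *)
Inductive join_closure (A : set (Lb E F)) : set (Lb E F) :=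
  | jc_in T : A T -> join_closure A T
  | jc_join S T U : join_closure A S -> join_closure A T ->
      is_sup [set S; T] U -> join_closure A U.

Lemma AM_compact_sup (A : set (Lb E F)) m :
  A `<=` [set T | AM_compact T] -> is_sup A m -> AM_compact m.
Proof.
move=> Ac [mA mleast].
have [[T0 AT0]|nA] := pselect (A !=set0); last first.
  (* the supremum of the empty set is a least element, hence 0 *)
  have m_le T : m <=v T.
    by apply: mleast => S AS; case: nA; exists S.
  suff -> : m = 0 by exact: AM_compact0.
  apply: vle_anti; first exact: m_le.
  by apply: (vle_by1 (m_le (m + m))); vec R.
pose B := join_closure A.
have Bc T : B T -> AM_compact T.
  elim=> [S /Ac//|S1 S2 U _ S1c _ S2c US].
  have [p [n [_ _ _ pc [pub pleast]]]] :=
    AM_compact_pos_part (AM_compactB S1c S2c).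
  suff -> : U = S2 + p by exact: AM_compactD.
  apply: is_sup_uniq US _; split=> [_ [|] ->|b bub].
  - by apply: (vle_by1 (pub (S1 - S2) (or_introl erefl))); vec R.
  - by apply: (vle_by1 (pub 0 (or_intror erefl))); vec R.
  suff h : p <=v b - S2 by apply: (vle_by1 h); vec R.
  apply: pleast => _ [|] ->.
    by apply: (vle_by1 (bub S1 (or_introl erefl))); vec R.
  by apply: (vle_by1 (bub S2 (or_intror erefl))); vec R.
have B0 : B !=set0 by exists T0; exact: jc_in.
have Bdir : directed_up B.
  move=> S T BS BT; have [J JP] := Lb_vector_lattice Fc S T.
  exists J; split; first exact: jc_join JP.
    by apply: JP.1; left.
  by apply: JP.1; right.
have mB T : B T -> T <=v m.
  elim=> [S /mA//|S1 S2 U _ S1m _ S2m US].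
  by apply: US.2 => _ [|] ->.
have [m' m'B m'x] := Lb_directed_sup Fc B0 Bdir mB.
have mm' : m = m'.
  apply: is_sup_uniq m'B; split => // b bub; apply: mleast => T AT.
  by apply: bub; exact: jc_in.
apply: AM_compact_approx => x e x0 e0.
have Bx0 : [set (T : Lb E F) x | T in B] !=set0.
  by exists (T0 x), T0 => //; exact: jc_in.
have Bxdir : directed_up [set (T : Lb E F) x | T in B].
  move=> _ _ [S BS <-] [T BT <-]; have [U [BU SU TU]] := Bdir _ _ BS BT.
  by exists (U x); split; [exists U|exact: SU|exact: TU].
have [_ [T BT <-] mTe] := directed_sup_approx hF Bx0 Bxdir (m'x _ x0) e0.
exists T; first exact: Bc.
have mT0 : 0 <=v m - T by apply/vle_sub_ge0; exact: mB.
move=> y [y0 yx]; apply: le_trans mTe; rewrite -mm'.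
by apply: norm_vle; [exact: mT0|exact: (Lb_pos_mono mT0 yx)].
Qed.

Lemma AM_compact_band : is_band [set T : Lb E F | AM_compact T].
Proof.
split.
- exact: Lb_vector_lattice.
- split; first exact: AM_compact0.
  by move=> a v w; exact: AM_compact_lin.
- exact: AM_compact_solid.
- exact: AM_compact_sup.
Qed.

End AMCompact.

Theorem proposition3p4 (R : realType) (E F : banachLatticeType R)
    (hF : order_continuous_norm F) :
  is_band [set T : Lb E F | AM_un_compact T] /\
  is_band [set T : Lb E F | AM_sigma_un_compact T].
Proof.
have -> : [set T : Lb E F | AM_un_compact T] = [set T | AM_compact T].
  by apply/seteqP; split=> T /AM_un_compactP.
have -> : [set T : Lb E F | AM_sigma_un_compact T] = [set T | AM_compact T].
  by apply/seteqP; split=> T /AM_sigma_un_compactP.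
by split; exact: AM_compact_band.
Qed.
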